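(* Let $p\ge q\ge2$. Almost surely, no cell of an IPVT, $\mathrm{IPVT}_\xi(\mathrm{DL}(p,q))$, of the (vertex-measured) Diestel--Leader graph $\mathrm{DL}(p,q)$ contains a bi-infinite geodesic.
   Context: Diestel--Leader graph. $T,T'$ are the $(p+1)$-regular and $(q+1)$-regular trees, with fixed vertices $o,o'$ and fixed ends $\omega_0,\omega'_0$. $u\wedge v$ is the common vertex of the geodesics $uv$, $u\omega_0$, $v\omega_0$ in $T$, and $h(u)=d(u,u\wedge o)-d(o,u\wedge o)$; $h'$ on $T'$ is defined similarly. $\mathrm{DL}(p,q)$ has vertex set $V=\{(v,v')\in T\times T':h(v)+h'(v')=0\}$ and $(v,v')\sim(w,w')$ iff $v\sim w$ and $v'\sim w'$. It carries the graph distance $d$ and the counting measure. A bi-infinite geodesic is a map $\gamma:\mathbb Z\to V$ with $d(\gamma(m),\gamma(n))=|m-n|$ for all $m,n$. For an end $\omega\in\partial T$ let $d_\omega(y)=\lim_{x\to\omega}(d(y,x)-d(o,x))$ and $\rho_\omega(y,y')=d_\omega(y)$; for $\omega'\in\partial T'$ define $d_{\omega'}$ similarly and $\rho'_{\omega'}(y,y')=d_{\omega'}(y')$. These are horofunctions of $\mathrm{DL}(p,q)$, giving embeddings of $\partial T,\partial T'$ into the horoboundary $\partial\,\mathrm{DL}(p,q)$. Let $\eta,\eta'$ be the harmonic measures on $\partial T,\partial T'$ (limit laws of simple random walk from $o$, resp. $o'$). IPVT. Every IPVT of $\mathrm{DL}(p,q)$ (weak limit as $\lambda_n\to0$ of Voronoi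 diagrams of Poisson point processes on $V$ of intensity $\lambda_n$) is of the form $\mathrm{IPVT}_\xi(\mathrm{DL}(p,q))=\mathrm{Vor}(\Phi)$ for some $\xi\in\mathbb R$, where $\Phi=(\Theta_i,\Delta_i)_i$ is the Poisson point process on $\partial\,\mathrm{DL}(p,q)\times\mathbb Z$ with intensity $\nu_0\otimes\beta^{(\xi)}$, $\beta^{(\xi)}(i)=(p-1)p^{i-1+\xi}$, $\nu_0=\eta$ if $p>q$ and $\nu_0=(\eta+\eta')/2$ if $p=q$. With $f_i$ equal to $\Delta_i$ plus the horofunction ($\rho_\omega$ or $\rho'_{\omega'}$) of $\Theta_i$, the cells are $C_i=\{z\in V:f_i(z)\le f_j(z)\ \forall j\}$. *)

(* Defs.v *)
From HB Require Import structures.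
From mathcomp Require Import all_boot all_order all_algebra.
From mathcomp Require Import all_classical all_reals all_analysis.

Set Implicit Arguments.
Unset Strict Implicit.
Unset Printing Implicit Defensive.

Import Order.TTheory GRing.Theory Num.Theory.
Import numFieldNormedType.Exports.

Local Open Scope classical_set_scope.
Local Open Scope ring_scope.

Section Graph.
Variables (V : choiceType) (e : rel V).

Definition has_walk (x y : V) (n : nat) : Prop :=
  exists p : seq V, [/\ path e x p, last x p = y & size p = n].

(* Junk value 0 if x and y are not connected. *)
Definition gdist (x y : V) : nat :=
  xget 0%N [set n | has_walk x y n /\ forall m, has_walk x y m -> (n <= m)%N].

Definition geod (x y : V) : set V :=
  [set z | (gdist x z + gdist z y)%N = gdist x y].

Definition is_tree : Prop :=
  [/\ symmetric e, irreflexive e,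
      forall x y, exists n, has_walk x y n
    & forall c : seq V, ucycle e c -> (size c < 3)%N].

Definition is_regular (k : nat) : Prop :=
  forall x, ([set y | e x y] #= `I_k)%card.

Definition is_ray (r : nat -> V) : Prop :=
  injective r /\ forall n, e (r n) (r n.+1).

Definition cofinal_rays (r s : nat -> V) : Prop :=
  exists a b : nat, forall n, r (a + n)%N = s (b + n)%N.

(* Ends of a tree: equivalence classes of rays. *)
Record gend := GEnd {
  gend_rays : set (nat -> V);
  gend_class : exists2 r, is_ray r &
    gend_rays = [set s | is_ray s /\ cofinal_rays r s] }.

(* Vertices of the geodesic from v to the end w. *)
Definition geod_end (v : V) (w : gend) : set V :=
  [set z | exists r, [/\ gend_rays w r, r 0%N = v & exists n, r n = z]].

Definition bigeodesic (g : int -> V) : Prop :=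
  forall m n : int, gdist (g m) (g n) = `|m - n|%N.

End Graph.

Record marked_tree (k : nat) := MarkedTree {
  vertex :> choiceType;
  adj : rel vertex;
  adj_tree : is_tree adj;
  adj_regular : is_regular adj k;
  tree_root : vertex;
  omega0 : gend adj }.

Definition tree_end (k : nat) (T : marked_tree k) : Type := gend (@adj k T).

HB.instance Definition _ k (T : marked_tree k) := gen_eqMixin (tree_end T).
HB.instance Definition _ k (T : marked_tree k) := gen_choiceMixin (tree_end T).
HB.instance Definition _ k (T : marked_tree k) :=
  isPointed.Build (tree_end T) (omega0 T).

Section Tree.
Variables (k : nat) (T : marked_tree k).
Local Notation d := (gdist (@adj k T)).
Local Notation o := (tree_root T).

(* In a tree the three geodesics have exactly one common vertex, so the default
   value is never used. *)
Definition confluent (u v : T) : T :=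
  xget u [set w | [/\ geod (@adj k T) u v w, geod_end u (omega0 T) w
                    & geod_end v (omega0 T) w]].

Definition height (u : T) : int :=
  (d u (confluent u o))%:Z - (d o (confluent u o))%:Z.

(* Trace on the vertices of the neighbourhoods of an end in the end
   compactification. *)
Definition to_end (w : tree_end T) : set_system T :=
  filter_from (geod_end o w) (fun v => [set x | geod (@adj k T) o x v]).

(* The Borel sigma-algebra of the boundary is generated by shadows. *)
Definition shadows : set (set (tree_end T)) :=
  range (fun v : T => [set w : tree_end T | geod_end o w v]).

Definition boundary := g_sigma_algebraType shadows.

Section Analysis.
Variable R : realType.

Definition busemann (w : tree_end T) (y : T) : R :=
  lim (((d y x)%:R - (d o x)%:R : R) @[x --> to_end w]).

Definition is_srw (D : measure_display) (Om : measurableType D)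
    (P : probability Om R) (X : nat -> Om -> T) : Prop :=
  (forall n v, measurable (X n @^-1` [set v])) /\
  forall (n : nat) (x : nat -> T),
    P [set s | forall i, (i <= n)%N -> X i s = x i] =
    ((x 0%N == o)%:R * \prod_(i < n) ((adj (x i) (x i.+1))%:R / k%:R))%:E.

Definition is_harmonic_measure (eta : probability boundary R) : Prop :=
  exists (D : measure_display) (Om : measurableType D) (P : probability Om R)
      (X : nat -> Om -> T) (Xoo : Om -> boundary),
    [/\ is_srw P X, measurable_fun setT Xoo,
        {ae P, forall s, X ^~ s @ \oo --> to_end (Xoo s)}
      & forall A, measurable A -> eta A = pushforward P Xoo A].

End Analysis.
End Tree.

Section PoissonProcess.
Local Open Scope ereal_scope.
Variable R : realType.

(* The library's poisson_pmf is not used because poisson_pmf 0 k = 1 for all k;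
   here rate 0 gives the point mass at 0. *)
Definition poisson_weight (r : R) (n : nat) : R :=
  (r ^+ n / n`!%:R * expR (- r))%R.

Section Process.
Variables (D D' : measure_display) (Om : measurableType D) (E : measurableType D').

Definition npoints (Z : nat -> Om -> E) (A : set E) (s : Om) : \bar R :=
  counting [set n | A (Z n s)].

(* Poisson point process of intensity mu, with its points enumerated (with
   multiplicity) by nat; such an enumeration requires mu setT = +oo. *)
Definition is_poisson_process (P : probability Om R) (mu : set E -> \bar R)
    (Z : nat -> Om -> E) : Prop :=
  [/\ forall n, measurable_fun setT (Z n),
      forall A, measurable A -> mu A \is a fin_num -> forall n : nat,
        P [set s | npoints Z A s = n%:R%:E] = (poisson_weight (fine (mu A)) n)%:E,
      forall A, measurable A -> mu A = +oo ->
        P [set s | npoints Z A s = +oo] = 1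
    & forall (n : nat) (A : 'I_n -> set E) (c : 'I_n -> \bar R),
        (forall j, measurable (A j)) -> trivIset setT A ->
        P (\bigcap_j [set s | npoints Z (A j) s = c j]) =
        \prod_j P [set s | npoints Z (A j) s = c j]].

End Process.
End PoissonProcess.

HB.instance Definition _ := isPointed.Build int 0.
HB.instance Definition _ := @isMeasurable.Build default_measure_display
  int discrete_measurable discrete_measurable0
  discrete_measurableC discrete_measurableU.

Section DiestelLeader.
Variables (k k' : nat) (T : marked_tree k) (T' : marked_tree k').

Definition DL : choiceType := {z : T * T' | height z.1 + height z.2 == 0}.

Definition DLadj : rel DL := fun z w =>
  adj (val z).1 (val w).1 && adj (val z).2 (val w).2.

Lemma DLroot_subproof : height (tree_root T) + height (tree_root T') == 0.
Proof. by rewrite /height !subrr. Qed.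

Definition DLroot : DL :=
  exist (fun z : T * T' => height z.1 + height z.2 == 0)
    (tree_root T, tree_root T') DLroot_subproof.

Section Horo.
Variable R : realType.

Definition horoboundary : set (DL -> R) :=
  [set f | exists x : nat -> DL,
     (gdist DLadj DLroot (x n))%:R @[n --> \oo] --> (+oo : set_system R) /\
     forall y, ((gdist DLadj y (x n))%:R - (gdist DLadj DLroot (x n))%:R : R)
               @[n --> \oo] --> f y].

(* Topology of pointwise convergence; since DL is countable, evaluations
   generate its Borel sigma-algebra. *)
Definition evaluation_sets : set (set (DL -> R)) :=
  [set A | exists z (B : set R), measurable B /\ A = [set f | B (f z)]].

Definition horospace := g_sigma_algebraType evaluation_sets.

Definition rhoT (w : boundary T) : horospace := fun z => busemann R w (val z).1.
Definition rhoT' (w : boundary T') : horospace := fun z => busemann R w (val z).2.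

Local Open Scope ereal_scope.

Section Intensity.
Variables (p q : nat) (eta : probability (boundary T) R)
  (eta' : probability (boundary T') R).

Definition nu0 (A : set horospace) : \bar R :=
  if (q < p)%N then pushforward eta rhoT A
  else (2^-1)%:E * (pushforward eta rhoT A + pushforward eta' rhoT' A).

Definition beta_xi (xi : R) (i : int) : R :=
  ((p%:R - 1) * p%:R `^ (i%:~R - 1 + xi))%R.

Definition intensity (xi : R) (A : set (horospace * int)) : \bar R :=
  \esum_(i in [set: int]) ((beta_xi xi i)%:E * nu0 [set th | A (th, i)]).

End Intensity.

Local Close Scope ereal_scope.

Definition horo_cell (Theta : nat -> horospace) (Delta : nat -> int) (i : nat)
    : set DL :=
  [set z | forall j, (Delta i)%:~R + Theta i z <= (Delta j)%:~R + Theta j z].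

End Horo.
End DiestelLeader.

(* The family (Theta_i, Delta_i)_i is the Poisson process on
   horoboundary x int whose Voronoi diagram is IPVT_xi(DL(p, q)). *)
Definition is_IPVT_nuclei (R : realType) (p q : nat) (T : marked_tree p.+1)
    (T' : marked_tree q.+1) (xi : R) (D : measure_display) (Om : measurableType D)
    (P : probability Om R) (Theta : nat -> Om -> horospace T T' R)
    (Delta : nat -> Om -> int) : Prop :=
  (forall i s, horoboundary (Theta i s)) /\
  exists (eta : probability (boundary T) R) (eta' : probability (boundary T') R),
    [/\ is_harmonic_measure eta, is_harmonic_measure eta'
      & is_poisson_process P (intensity p q eta eta' xi)
          (fun i s => (Theta i s, Delta i s))].

(* Main.v *)
(** A bi-infinite geodesic of DL(p, q) changes vertical direction at most once: two
    consecutive turns at distance l would leave a path of length 3l whose endpoints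
    are joined by a vertical path of length l. Hence every horofunction of an end of T
    other than omega0, or of an end of T' other than omega0', grows linearly along one
    of the two halves of the geodesic, and harmonic measure does not charge omega0 and
    omega0'. So a geodesic inside a cell would provide, for some C and every m, a vertex z
    at distance m from its starting point such that all f_j(z) are at least m - C.

    The harmonic measure of the shadow of a vertex y at depth n is p^-n p / (p + 1).
    Its ends have horofunction -n at y, so the mean number of nuclei j with
    Delta_j = m - C - 1 + n and f_j(z) < m - C is at least c p^m, uniformly in
    z = (y, y'). There are at most exponentially many candidates z, each of which is
    such a vertex with probability at most exp(-c p^m), so almost surely some m
    admits none. *)
Require Import Defs.
From mathcomp Require Import all_boot all_order all_algebra.
From mathcomp Require Import all_classical all_reals all_analysis.
From mathcomp Require Import measurable_realfun zify ring lra.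

Set Implicit Arguments.
Unset Strict Implicit.
Unset Printing Implicit Defensive.

Import Order.TTheory GRing.Theory Num.Theory.
Import numFieldNormedType.Exports.

Local Open Scope classical_set_scope.
Local Open Scope ring_scope.

(** * Trees *)

(** There are uncountably many geodesics, so null sets cannot be collected one geodesic at a time.
    Of a geodesic only three integers are kept: the lengths [L], [L'] of walks from the roots to the
    coordinates of the starting vertex, and a bound [C]. For each of these countably many triples,
    an event of probability zero contains all the exceptional configurations.

    The nuclei are points of a function space, carry no label by an end, and are known to the
    Poisson process only through measurable sets. Instead of recovering the end, the proof isolates
    the countably many relations between evaluations that the growth argument uses ([good_horo]),
    and shows that the other functions have intensity zero.

    The growth rests on one mechanism: a non-backtracking path in a tree that once moves away from a
    vertex or an end does so forever. The projection of a geodesic to a tree backtracks at a peak of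
    the height and at no other time: at a valley the other coordinate has a peak, and both would
    backtrack at once. *)

Section Distance.
Variables (V : choiceType) (e : rel V).
Local Notation d := (gdist e).

Lemma gdist_walk x y n : has_walk e x y n ->
  has_walk e x y (d x y) /\ (d x y <= n)%N.
Proof.
move=> xyn; suff : has_walk e x y (d x y) /\
    forall m, has_walk e x y m -> (d x y <= m)%N by case=> ? /(_ _ xyn).
have ex : exists m, (fun m => `[< has_walk e x y m >]) m by exists n; apply/asboolP.
suff /(xgetPex 0%N) : exists k, has_walk e x y k /\
    forall m, has_walk e x y m -> (k <= m)%N by [].
exists (ex_minn ex); case: ex_minnP => m /asboolP xym min; split=> // l xyl.
by apply: min; apply/asboolP.
Qed.

Lemma gdist_le x y n : has_walk e x y n -> (d x y <= n)%N.
Proof. by move/gdist_walk => []. Qed.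

Lemma has_walk0 x y : has_walk e x y 0 <-> x = y.
Proof. by split=> [[[|? ?] [//]]|->] //; exists [::]. Qed.

Lemma has_walkS x z n :
  has_walk e x z n.+1 <-> exists2 y, e x y & has_walk e y z n.
Proof.
split=> [[[|y s] [] //= /andP[exy p] l [sz]]|[y exy [s [p l sz]]]].
  by exists y => //; exists s.
by exists (y :: s); rewrite /= exy p sz.
Qed.

Lemma has_walk1 x y : has_walk e x y 1 <-> e x y.
Proof.
rewrite has_walkS; split=> [[z exz /has_walk0 <- //]|exy].
by exists y => //; apply/has_walk0.
Qed.

Lemma has_walk_cat x y z m n :
  has_walk e x y m -> has_walk e y z n -> has_walk e x z (m + n).
Proof.
move=> [s [ps ls zs]] [t [pt lt zt]]; exists (s ++ t).
by rewrite cat_path last_cat ps ls pt lt size_cat zs zt.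
Qed.

Lemma has_walk_seq (w : nat -> V) n : (forall i, (i < n)%N -> e (w i) (w i.+1)) ->
  has_walk e (w 0%N) (w n) n.
Proof.
elim: n => [|n IH] ew; first exact/has_walk0.
rewrite -addn1; apply: has_walk_cat (IH _) _; first by move=> i im; apply: ew; lia.
by apply/has_walk1; rewrite addn1; exact: ew.
Qed.

Hypothesis e_sym : symmetric e.

Lemma has_walk_sym x y n : has_walk e x y n -> has_walk e y x n.
Proof.
elim: n x => [|n IH] x; first by move=> /has_walk0 ->; apply/has_walk0.
move=> /has_walkS[z exz /IH yzn]; rewrite -addn1; apply: has_walk_cat yzn _.
by apply/has_walk1; rewrite e_sym.
Qed.

Hypothesis e_conn : forall x y, exists n, has_walk e x y n.

Lemma has_walk_gdist x y : has_walk e x y (d x y).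
Proof. by have [n /gdist_walk[]] := e_conn x y. Qed.

Lemma gdistC x y : d x y = d y x.
Proof.
by apply/eqP; rewrite eqn_leq !gdist_le//; apply/has_walk_sym/has_walk_gdist.
Qed.

Lemma gdist_tri x y z : (d x z <= d x y + d y z)%N.
Proof. by apply/gdist_le/has_walk_cat; apply: has_walk_gdist. Qed.

Lemma gdist_eq0 x y : d x y = 0%N <-> x = y.
Proof.
split=> [xy|->]; first by apply/has_walk0; rewrite -xy; exact: has_walk_gdist.
by apply/eqP; rewrite -leqn0; apply/gdist_le/has_walk0.
Qed.

Lemma gdistxx x : d x x = 0%N. Proof. exact/gdist_eq0. Qed.

Lemma gdist_edge x y : e x y -> (d x y <= 1)%N.
Proof. by move=> exy; apply/gdist_le/has_walk1. Qed.

Lemma gdist_pred r x n : d r x = n.+1 -> exists2 a, e x a & d r a = n.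
Proof.
move=> rx; have := has_walk_gdist x r; rewrite gdistC rx => /has_walkS[a exa ar].
exists a => //; have := gdist_le ar; rewrite gdistC.
by have := gdist_edge exa; have := gdist_tri r a x; rewrite (gdistC a x); lia.
Qed.

Lemma geodP x y z :
  geod e x y z <-> (d x z + d z y)%N = d x y.
Proof. by []. Qed.

End Distance.

(* Abstracts from the distance to a vertex, or to an end, the only property used
   below: every vertex has at most one neighbour with a smaller value. *)
Definition horo (V : choiceType) (e : rel V) (S : numDomainType) (F : V -> S) :=
  (forall a b, e a b -> F b = F a + 1 \/ F a = F b + 1) /\
  (forall a b c, e a b -> e b c -> a != c -> F b = F a + 1 -> F c = F b + 1).

Section Horo.
Variables (V : choiceType) (e : rel V) (S : numDomainType) (F : V -> S).
Hypothesis hF : horo e F.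

Lemma horo_dec a b c : e b a -> e b c -> symmetric e ->
  F b = F a + 1 -> F b = F c + 1 -> a = c.
Proof.
move=> eba ebc se Fa Fc; apply/eqP; apply: contraT => ac.
have := hF.2 a b c; rewrite se eba => /(_ isT ebc ac Fa); rewrite Fc.
rewrite -addrA -{1}[F c]addr0 => /addrI/esym/eqP.
by rewrite -[1 + 1]/(2%:R) pnatr_eq0.
Qed.

(** After one increase the unique neighbour with a smaller value is the vertex just left, so a
    non-backtracking path can never decrease again. *)
Lemma horo_seq (w : nat -> V) : (forall i, e (w i) (w i.+1)) ->
  (forall i, w i != w i.+2) -> F (w 1%N) = F (w 0%N) + 1 ->
  forall n, F (w n) = F (w 0%N) + n%:R.
Proof.
move=> ew nb F1 n; have st i : F (w i.+1) = F (w i) + 1.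
  by elim: i => [//|i IH]; apply: (hF.2 (w i)).
by elim: n => [|n IH]; rewrite ?addr0// st IH -addrA natr1.
Qed.

End Horo.

Section Tree.
Variables (V : choiceType) (e : rel V).
Hypothesis tr : is_tree e.
Local Notation d := (gdist e).

Let e_sym : symmetric e. Proof. by case: tr. Qed.
Let e_conn x y : exists n, has_walk e x y n. Proof. by case: tr. Qed.

Lemma tree_neq x y : e x y -> x != y.
Proof. by case: tr => _ irr _ _ exy; apply: contraTneq exy => ->; rewrite irr. Qed.

(** A path from [a] to [b] avoiding [x] could be shortened to a simple one and closed up through [x]
    into a cycle of length at least 3. *)
Lemma tree_path_neighbours x a b s : e x a -> e x b -> a != b ->
  path e a s -> last a s = b -> x \in a :: s.
Proof.
move=> exa exb ab ps ls; apply: contraT => xs; case: tr => _ _ _ acyc.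
case: (shortenP ps) ls => s' ps' us' sub ls'.
suff /acyc/= : ucycle e [:: x, a & s'].
  by case: s' ls' {ps' us' sub} => [/= ls'|//]; rewrite ls' eqxx in ab.
have xs' : x \notin a :: s'.
  by apply: contra xs; rewrite !inE => /orP[->//|/sub ->]; rewrite orbT.
by apply/andP; split; [rewrite /= exa rcons_path ps' ls' e_sym exb | rewrite cons_uniq xs'].
Qed.

(** Both neighbours are joined to [r] by shortest walks that avoid [x], hence to each other. The
    non-strict inequalities make the lemma also exclude edges between vertices at equal distance
    from [r], in [tree_edge_dist]. *)
Lemma tree_le_neighbour_uniq r x a b : e x a -> e x b ->
  (d r a <= d r x)%N -> (d r b <= d r x)%N -> a = b.
Proof.
move=> exa exb ax bx; apply/eqP; apply: contraT => ab.
(* The graph with [x] deleted. A shortest walk to [r] from another vertex at most as far as [x]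
   stays in it, as all later vertices are strictly closer than [x]. *)
pose e' := [rel u v | [&& e u v, u != x & v != x]].
have e'_sym : symmetric e' by move=> u v /=; rewrite e_sym [(u != x) && _]andbC.
have toroot n c : d r c = n -> (n <= d r x)%N -> c != x -> has_walk e' c r n.
  elim: n c => [|n IH] c rc nx cx.
    by apply/has_walk0/esym/(gdist_eq0 e_conn).
  have [a1 eca1 ra1] := gdist_pred e_sym e_conn rc.
  have a1x : a1 != x by apply: contraTneq nx => <-; rewrite ra1 ltnn.
  by apply/has_walkS; exists a1; rewrite /= ?eca1 ?cx//; apply: IH => //; lia.
have [ax' bx'] : a != x /\ b != x by rewrite eq_sym tree_neq// eq_sym tree_neq.
have [s [ps ls _]] := has_walk_cat (toroot _ _ erefl ax ax')
  (has_walk_sym e'_sym (toroot _ _ erefl bx bx')).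
have [pse xs] : path e a s /\ x \notin s.
  elim: s (a) ps {ls} => [//|c s IH] u /= /andP[/and3P[euc _ cx] /IH[-> xs]].
  by rewrite euc inE negb_or eq_sym cx.
have := tree_path_neighbours exa exb ab pse ls.
by rewrite inE eq_sym (negbTE ax') (negbTE xs).
Qed.

Lemma tree_edge_dist r x y : e x y -> d r y = (d r x).+1 \/ d r x = (d r y).+1.
Proof.
move=> exy; have [] := (gdist_tri e_conn r x y, gdist_tri e_conn r y x).
have := gdist_edge exy; rewrite (gdistC e_sym e_conn y x).
suff: d r x != d r y by move=> /eqP ? ? ? ?; lia.
apply/eqP => rxy; case rx: (d r x) => [|n].
  have /eqP := tree_neq exy; apply; rewrite -(gdist_eq0 e_conn r x).1//.
  by rewrite -(gdist_eq0 e_conn r y).1// -rxy.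
have [b exb rb] := gdist_pred e_sym e_conn rx.
have yb : y = b by apply: (@tree_le_neighbour_uniq r x); rewrite // ?rb -?rxy// rx.
by move: rxy; rewrite yb rb rx; lia.
Qed.

Lemma horo_gdist (S : numDomainType) r : horo e (fun x => (d r x)%:R : S).
Proof.
split=> [a b eab|a b c eab ebc ac].
  by case: (tree_edge_dist r eab) => ->; rewrite -natr1; [left|right].
move=> /= /eqP; rewrite natr1 eqr_nat => /eqP rab; apply/eqP; rewrite natr1 eqr_nat.
case: (tree_edge_dist r ebc) => [->//|rbc]; case/eqP: ac.
by apply: (@tree_le_neighbour_uniq r b a c _ ebc); rewrite 1?e_sym//; lia.
Qed.

Lemma gdist_seq (w : nat -> V) : (forall i, e (w i) (w i.+1)) ->
  (forall i, w i != w i.+2) -> forall n, d (w 0%N) (w n) = n.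
Proof.
move=> ew nb n; apply/eqP; rewrite -(@eqr_nat int); apply/eqP.
rewrite (horo_seq (horo_gdist int (w 0%N)) ew nb) ?gdistxx ?add0r//.
by case: (tree_edge_dist (w 0%N) (ew 0%N)) => [->|]; rewrite gdistxx.
Qed.

End Tree.

(** * Rays and ends of a tree *)

Section TreeEnds.
Variables (V : choiceType) (e : rel V).
Hypothesis tr : is_tree e.
Local Notation d := (gdist e).

Let e_sym : symmetric e. Proof. by case: tr. Qed.
Let e_conn x y : exists n, has_walk e x y n. Proof. by case: tr. Qed.
Local Notation dC := (gdistC e_sym e_conn).
Local Notation d_tri := (gdist_tri e_conn).

(** The geodesic from [c] to [x] continues the edge from [a] to [c] without backtracking, so [F]
    keeps increasing along it. *)
Lemma horo_geod (S : numDomainType) (F : V -> S) a c x : horo e F -> e a c ->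
  d a x = (d c x).+1 -> F c = F a + 1 -> F x = F c + (d c x)%:R.
Proof.
move=> hF; move En: (d c x) => n; elim: n a c En => [|n IH] a c cx eac ax Fc.
  by rewrite addr0 ((gdist_eq0 e_conn c x).1 cx).
have [c1 ecc1 c1x] : exists2 c1, e c c1 & d x c1 = n.
  by apply: gdist_pred => //; rewrite dC.
have Fc1 : F c1 = F c + 1.
  apply: (hF.2 a) => //; apply: contra_eq_neq ax => ->.
  by rewrite dC c1x; lia.
by rewrite (IH c c1) ?(dC c1)// Fc1 -natr1 -addrA [1 + _]addrC.
Qed.

(** Lying behind [c] as seen from [r] depends only on the edge from [a] to [c]; this turns shadows
    into half-trees, first in [sub_end_height] and later in [beyond]. *)
Lemma geod_side r a c x : e a c -> d r c = (d r a).+1 ->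
  geod e r x c <-> d a x = (d c x).+1.
Proof.
move=> eac rc; have := tree_edge_dist tr x eac; rewrite !(dC x) geodP => cmp.
split=> [rcx|ax]; first by have ? := d_tri r a x; lia.
have rc1 : (d r c)%:R = (d r a)%:R + 1 :> int by rewrite rc natr1.
have /eqP := horo_geod (horo_gdist tr int r) eac ax rc1.
by rewrite -natrD eqr_nat => /eqP ->.
Qed.

Lemma geod_trans r x c b : geod e r x c -> geod e r c b -> geod e r x b.
Proof. by rewrite !geodP; have [? ?] := (d_tri r b x, d_tri b c x); lia. Qed.

(** Induction from [x] backwards: the next vertices towards [x] coincide, and [c], [c'] are both
    neighbours of that vertex closer to [r]. *)
Lemma geod_level_uniq r x c c' :
  geod e r x c -> geod e r x c' -> d r c = d r c' -> c = c'.
Proof.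
rewrite !geodP; move En: (d c x) => n.
elim: n c c' En => [|n IH] c c' cx gc gc' cc'.
  have c'x : d c' x = 0%N by lia.
  by rewrite (gdist_eq0 e_conn c x).1// (gdist_eq0 e_conn c' x).1.
have c'x : d c' x = n.+1 by lia.
rewrite c'x in gc'; have next b : d b x = n.+1 -> (d r b + n.+1)%N = d r x ->
    exists c1, [/\ e b c1, d c1 x = n & d r c1 = (d r b).+1].
  rewrite dC => bx gb; have [c1 ebc1 c1x] := gdist_pred e_sym e_conn bx.
  rewrite dC in c1x; exists c1; split=> //.
  by have [? ?] := (d_tri r c1 x, tree_edge_dist tr r ebc1); lia.
have [c1 [ecc1 c1x rc1]] := next c cx gc; have [c2 [ecc2 c2x rc2]] := next c' c'x gc'.
have c12 : c1 = c2 by apply: IH => //; lia.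
by subst c2; apply: (@tree_le_neighbour_uniq _ _ tr r c1); rewrite 1?e_sym//; lia.
Qed.

Lemma ray_dist r i n : is_ray e r -> d (r i) (r (i + n)%N) = n.
Proof.
move=> [inj er]; rewrite -{1}[i]addn0.
apply: (@gdist_seq _ _ tr (fun n => r (i + n)%N)) => j.
  by rewrite addnS; exact: er.
by apply/eqP => /inj; lia.
Qed.

Lemma ray_extend u r N : is_ray e r ->
  (forall n, d u (r (N + n)%N) = (d u (r N) + n)%N) ->
  exists s, [/\ is_ray e s, s 0%N = u & forall n, s (d u (r N) + n)%N = r (N + n)%N].
Proof.
move=> rr; move En: (d u (r N)) => n; elim: n u En => [|n IH] u uN inc.
  exists (fun n => r (N + n)%N); rewrite ((gdist_eq0 e_conn u (r N)).1 uN).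
  rewrite addn0; split=> //; split=> [i j /(rr.1)|i]; first by lia.
  by rewrite addnS; exact: rr.2.
have [u1 eu1 u1N] : exists2 u1, e u u1 & d (r N) u1 = n by apply: gdist_pred; rewrite // dC.
rewrite dC in u1N; have inc1 m : d u1 (r (N + m)%N) = (n + m)%N.
  have := d_tri u1 (r N) (r (N + m)%N); rewrite (ray_dist _ _ rr) u1N.
  have := tree_edge_dist tr (r (N + m)%N) eu1; have := inc m.
  by rewrite !(dC (r (N + m)%N)) => ? ? ?; lia.
have [s [sr s0 sN]] := IH u1 u1N inc1.
(* Prepending [u] must keep the ray injective. If [s m = u], then [m <= 1] and [r (N + 2)] would be
   at distance [n + 2 - m] from [u], whereas [inc] puts it at distance [n + 3]. *)
have us m : s m != u.
  apply/eqP => sm; have := ray_dist 0 m sr; rewrite add0n s0 sm.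
  have := gdist_edge eu1; rewrite dC => u1u m1.
  rewrite m1 in u1u.
  have := ray_dist m (n + 2 - m) sr; rewrite sm.
  have -> : (m + (n + 2 - m) = n + 2)%N by lia.
  by rewrite sN inc => ?; lia.
exists (fun m => if m is m'.+1 then s m' else u); split=> //.
  split=> [[|i] [|j]//|[|i]]; last exact: sr.2.
  - by move/esym/eqP; rewrite (negbTE (us _)).
  - by move/eqP; rewrite (negbTE (us _)).
  - by move/(sr.1) ->.
  - by rewrite s0.
Qed.

Lemma gend_rays_ray (w : gend e) s : gend_rays w s -> is_ray e s.
Proof. by have [r _ ->] := gend_class w; case. Qed.

Lemma gend_rays_cofinal (w : gend e) s s' :
  gend_rays w s -> gend_rays w s' -> cofinal_rays s s'.
Proof.
have [r _ ->] := gend_class w => -[_ [a [b rs]]] [_ [a' [b' rs']]].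
exists (b + a')%N, (b' + a)%N => n; rewrite -!addnA -rs -rs'; congr r; lia.
Qed.

Lemma gend_rays_trans (w : gend e) s s' :
  gend_rays w s -> is_ray e s' -> cofinal_rays s s' -> gend_rays w s'.
Proof.
have [r _ ->] := gend_class w => -[_ [a [b rs]]] s'r [a' [b' ss']].
split=> //; exists (a + a')%N, (b' + b)%N => n.
by rewrite -addnA rs -addnA -ss'; congr s; lia.
Qed.

Lemma ray_from_through u (w : gend e) r N : gend_rays w r ->
  (forall n, d u (r (N + n)%N) = (d u (r N) + n)%N) ->
  exists s, [/\ gend_rays w s, s 0%N = u & s (d u (r N)) = r N].
Proof.
move=> wr inc; have [s [sr s0 sN]] := ray_extend (gend_rays_ray wr) inc.
exists s; split=> //; last by rewrite -[LHS]/(s _) -[d u (r N)]addn0 sN addn0.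
by apply: gend_rays_trans wr sr _; exists N, (d u (r N)) => n; rewrite sN.
Qed.

Lemma ray_increasing u r N : is_ray e r -> d u (r N.+1) = (d u (r N)).+1 ->
  forall n, d u (r (N + n)%N) = (d u (r N) + n)%N.
Proof.
move=> rr rN n; apply/eqP; rewrite -(@eqr_nat int) natrD; apply/eqP.
rewrite (@horo_seq _ _ _ _ (horo_gdist tr int u) (fun n => r (N + n)%N)) ?addn0//.
- by move=> i; rewrite addnS; exact: rr.2.
- by move=> i; apply/eqP => /(rr.1); lia.
- by rewrite addn1 rN natr1.
Qed.

(** Along a ray of [w] the distance to [u] cannot decrease forever. After its first increase it
    always increases, and the geodesic from [u] can be attached there. *)
Lemma ray_from u (w : gend e) : exists2 s, gend_rays w s & s 0%N = u.
Proof.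
have [r rr wE] := gend_class w.
have wr : gend_rays w r by rewrite wE; split=> //; exists 0%N, 0%N.
suff [N rN] : exists N, d u (r N.+1) = (d u (r N)).+1.
  by have [s [sr s0 _]] := ray_from_through wr (ray_increasing rr rN); exists s.
apply: contrapT => no; have dec n : (d u (r n) + n = d u (r 0%N))%N.
  elim: n => [|n IH]; first by rewrite addn0.
  have := tree_edge_dist tr u (rr.2 n); case=> [rn|]; last by lia.
  by case: no; exists n.
by have := dec (d u (r 0%N)).+1; lia.
Qed.

(** Tails of the two rays agree, and with equal shifts, because the index of a vertex is its
    distance from the common origin. Earlier vertices lie on the geodesic to a common far vertex, at
    equal levels. *)
Lemma ray_uniq (w : gend e) s s' : gend_rays w s -> gend_rays w s' ->
  s 0%N = s' 0%N -> s =1 s'.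
Proof.
move=> ws ws' ss'; have [a [b ab]] := gend_rays_cofinal ws ws'.
have [sr sr'] := (gend_rays_ray ws, gend_rays_ray ws').
have [ds ds'] := (fun n => ray_dist 0 n sr, fun n => ray_dist 0 n sr').
have {}ab n : s (a + n)%N = s' (a + n)%N.
  have ba : b = a; last by rewrite ab ba.
  by have := ab 0%N; rewrite !addn0 => E; rewrite -(ds a) -(ds' b) !add0n ss' E.
move=> n; apply: (@geod_level_uniq (s 0%N) (s (n + a)%N)).
- by rewrite geodP (ds n) (ray_dist n) // (ds (n + a)%N).
- rewrite geodP ss' [(n + a)%N]addnC ab [(a + n)%N]addnC.
  by rewrite (ds' n) (ray_dist n) // (ds' (n + a)%N).
- by rewrite {2}ss' (ds n) (ds' n).
Qed.

End TreeEnds.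

(** * Ends and Busemann functions *)

Lemma horo_int (V : choiceType) (e : rel V) (S : numDomainType) (F : V -> int) :
  horo e F -> horo e (fun x => (F x)%:~R : S).
Proof.
have E (m n : int) : n%:~R = m%:~R + 1 :> S <-> n = m + 1.
  by split=> [|->]; rewrite ?intrD// -[1]/(1%:~R) -intrD => /intr_inj.
move=> [hE hNB]; split=> [a b /hE[] ab|a b c eab ebc ac /E Fb].
- by left; apply/E.
- by right; apply/E.
by apply/E/(hNB a).
Qed.

Section Ends.
Variables (k : nat) (T : marked_tree k).
Local Notation d := (gdist (@adj k T)).
Local Notation o := (tree_root T).

Let tr := @adj_tree k T.
Let e_sym : symmetric (@adj k T). Proof. by case: tr. Qed.
Let e_conn (x y : T) : exists n, has_walk (@adj k T) x y n. Proof. by case: tr. Qed.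
Local Notation dC := (gdistC e_sym e_conn).
Local Notation d_tri := (gdist_tri e_conn).

Lemma eray_exists (w : tree_end T) : exists s, gend_rays w s /\ s 0%N = o.
Proof. by have [s ws s0] := ray_from tr o w; exists s. Qed.

Definition eray (w : tree_end T) : nat -> T := sval (cid (eray_exists w)).

Lemma erayP w : gend_rays w (eray w).
Proof. by rewrite /eray; case: cid => s []. Qed.

Lemma eray0 w : eray w 0%N = o.
Proof. by rewrite /eray; case: cid => s []. Qed.

Lemma eray_ray w : is_ray (@adj k T) (eray w).
Proof. exact: gend_rays_ray (erayP w). Qed.

Lemma eray_dist w i n : d (eray w i) (eray w (i + n)%N) = n.
Proof. exact: (ray_dist tr i n (eray_ray w)). Qed.

Lemma depth_eray w n : d o (eray w n) = n.
Proof. by rewrite -{2}(eray_dist w 0 n) add0n eray0. Qed.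

Lemma geod_endP w v : geod_end o w v <-> v = eray w (d o v).
Proof.
split=> [[s [ws s0 [n <-]]]|->]; last first.
  by exists (eray w); rewrite eray0; split; [exact: erayP| |exists (d o v)].
rewrite (ray_uniq tr ws (erayP w)) ?eray0// depth_eray.
by [].
Qed.

Lemma geod_eray w m n : (m <= n)%N -> geod (@adj k T) o (eray w n) (eray w m).
Proof.
move=> mn; have := eray_dist w m (n - m); rewrite subnKC// geodP !depth_eray => ->.
by rewrite subnKC.
Qed.

(** The geodesic from the root to a vertex behind [eray w n] shares its first [n] steps with the ray
    to [w]. *)
Lemma sub_shadow w y n x : (d o y <= n)%N -> geod (@adj k T) o x (eray w n) ->
  geod (@adj k T) o x y <-> y = eray w (d o y).
Proof.
move=> yn /(geod_trans tr) /(_ (geod_eray w yn)) xy; split=> [xy'|->//].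
by apply: (geod_level_uniq tr xy' xy); rewrite depth_eray.
Qed.

(** The Busemann function of [w] in integer form. The limit is already attained at the ray vertex
    whose depth is that of [y], by [sub_end_height]. *)
Definition end_height (w : tree_end T) (y : T) : int :=
  (d y (eray w (d o y)))%:Z - (d o y)%:Z.

Lemma sub_end_height w y n x : (d o y <= n)%N ->
  geod (@adj k T) o x (eray w n) -> (d y x)%:Z - (d o x)%:Z = end_height w y.
Proof.
move=> yn xn; set m := d o y; set z := eray w m.
have xm : geod (@adj k T) o x z by apply: (geod_trans tr) xn _; exact: geod_eray.
(* All points behind [z] give the same difference. In the induction on the depth of [y'], the change
   across an edge is decided by the side on which the point lies, and this side is common to all
   points behind [z]. *)
suff : forall y' x x', (d o y' <= m)%N -> geod (@adj k T) o x z ->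
    geod (@adj k T) o x' z -> (d y' x + d o x' = d y' x' + d o x)%N.
  move=> /(_ y x z (leqnn _) xm) H.
  have zz : geod (@adj k T) o z z by exact: geod_eray.
  by have := H zz; rewrite /end_height -/m -/z depth_eray; lia.
move=> {yn xn xm} y'; move Ey: (d o y') => l; elim: l y' Ey => [|l IH] c cl u v lm um vm.
  by rewrite -((gdist_eq0 e_conn o c).1 cl) addnC.
have [a eca al] := gdist_pred e_sym e_conn cl; rewrite e_sym in eca.
have := IH a al u v (ltnW lm) um vm.
have ocm : (d o c <= m)%N by rewrite cl.
have := tree_edge_dist tr u eca; have := tree_edge_dist tr v eca.
have oca : d o c = (d o a).+1 by rewrite cl al.
have [cu cv] := (sub_shadow ocm um, sub_shadow ocm vm).
have [su sv] := (geod_side tr u eca oca, geod_side tr v eca oca).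
rewrite !(dC u) !(dC v) => ev eu ih.
have [uv vu] : (d a u = (d c u).+1 -> d a v = (d c v).+1) /\
    (d a v = (d c v).+1 -> d a u = (d c u).+1).
  by split=> [/su.2/cu.1/cv.2/sv.1|/sv.2/cv.1/cu.2/su.1].
by case: eu => [eu|/[dup]/uv ? ?]; [case: ev => [ev|/[dup]/vu ? ?]|]; lia.
Qed.

Lemma end_height_eray w n y : (d o y <= n)%N ->
  end_height w y = (d y (eray w n))%:Z - n%:Z.
Proof. by move=> yn; rewrite -(sub_end_height yn (geod_eray w (leqnn n))) depth_eray. Qed.

(** On finitely many vertices [end_height w] is the distance to one far vertex of the ray, up to a
    constant. *)
Lemma horo_end_height w : horo (@adj k T) (end_height w).
Proof.
split=> [a b eab|a b c eab ebc ac].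
  pose n := (d o a + d o b)%N; rewrite !(@end_height_eray w n) ?leq_addr ?leq_addl//.
  have [ab|ab] := tree_edge_dist tr (eray w n) eab; rewrite !(dC _ (eray w n)) ab.
    by left; lia.
  by right; lia.
pose n := (d o a + d o b + d o c)%N; rewrite !(@end_height_eray w n); try lia.
have := (horo_gdist tr int (eray w n)).2 a b c eab ebc ac.
rewrite !(dC (eray w n)) /= !natz => H ab.
by have := H ltac:(lia); lia.
Qed.

Lemma end_height_root w : end_height w o = 0.
Proof. by rewrite (@end_height_eray w 0) ?gdistxx// eray0 gdistxx. Qed.

Lemma end_height_shadow w y :
  end_height w y = - (d o y)%:Z <-> geod_end o w y.
Proof.
rewrite geod_endP /end_height; split=> [yw|->].
  by apply/(gdist_eq0 e_conn); lia.
by rewrite depth_eray gdistxx// sub0r.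
Qed.

(** Iterated from the root, this expresses the Busemann function as a finite combination of shadow
    indicators, whence its measurability in [w]. *)
Lemma end_height_pred w a c : adj a c -> d o c = (d o a).+1 ->
  end_height w c = end_height w a + (1 - 2 * `[< geod_end o w c >]%:Z).
Proof.
move=> eac ca; pose x := eray w (d o c).
have sub := sub_shadow (leqnn _) (geod_eray w (leqnn (d o c))).
have side : geod_end o w c <-> d a x = (d c x).+1.
  rewrite geod_endP; split=> [/sub/(geod_side tr x eac ca)//|].
  by move=> /(geod_side tr x eac ca)/sub.
have := tree_edge_dist tr x eac; rewrite !(dC x).
rewrite (@end_height_eray w (d o c))// (@end_height_eray w (d o c) a) ?ca//.
rewrite -ca -/x => cmp; case: asboolP => [/side h|h]; first by lia.
have {}h : d a x <> (d c x).+1 by move/side.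
by lia.
Qed.

Lemma to_end_proper (w : tree_end T) : ProperFilter (to_end w).
Proof.
apply: filter_from_proper; last by move=> v _; exists v; rewrite /= geodP gdistxx// addn0.
apply: filter_from_filter; first by exists o; apply/geod_endP; rewrite gdistxx// eray0.
move=> u v /geod_endP uw /geod_endP vw; pose n := maxn (d o u) (d o v).
exists (eray w n); first by apply/geod_endP; rewrite depth_eray.
move=> x xn; have [un vn] : (d o u <= n)%N /\ (d o v <= n)%N.
  by rewrite leq_maxl leq_maxr.
by split; [apply/(sub_shadow un xn)|apply/(sub_shadow vn xn)].
Qed.

Lemma busemann_end_height (R : realType) (w : tree_end T) y :
  busemann R w y = (end_height w y)%:~R.
Proof.
have ? := to_end_proper w.
apply: cvg_lim => //; apply: cvg_near_cst.
exists (eray w (d o y)); first by apply/geod_endP; rewrite depth_eray.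
move=> x xy /=; rewrite -(sub_end_height (leqnn _) xy) intrD.
by rewrite rmorphN.
Qed.

(** The vertex is the last one of the ray from the root to [omega0] that lies on the geodesic from
    [u] to the root; past it the ray moves away from [u]. *)
Lemma confluent_exists u : exists z : T,
  [/\ geod (@adj k T) u o z, geod_end u (omega0 T) z & geod_end o (omega0 T) z].
Proof.
pose r := eray (omega0 T).
have ex : exists j, (fun j => d u (r j) + j == d u o)%N j by exists 0%N; rewrite addn0 /r eray0.
have bnd j : (d u (r j) + j == d u o)%N -> (j <= d u o)%N by move/eqP => <-; exact: leq_addl.
case: (ex_maxnP ex bnd) => j /eqP uj jmax.
have inc : d u (r j.+1) = (d u (r j)).+1.
  have [//|dec] := tree_edge_dist tr u ((eray_ray (omega0 T)).2 j).
  by have := jmax j.+1; rewrite -/r in dec *; rewrite -uj dec addSnnS eqxx ltnn => /(_ isT).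
have [s [ws s0 sj]] := ray_from_through tr (erayP _)
  (ray_increasing tr (eray_ray (omega0 T)) inc).
exists (r j); split.
- by rewrite geodP (dC (r j)) depth_eray uj.
- by exists s; split=> //; exists (d u (r j)).
- by apply/geod_endP; rewrite depth_eray.
Qed.

(** The rays from [u] and from the root merge, so any vertex common to both gives the same
    difference of distances as a far vertex [x] does. *)
Lemma height_end_height u : height u = end_height (omega0 T) u.
Proof.
have := xgetPex u (confluent_exists u); rewrite /height /confluent.
move: (xget _ _) => z [_ [s [ws s0 [i si]]] [r [wr r0 [j rj]]]].
have [sr rr] := (gend_rays_ray ws, gend_rays_ray wr).
have [a [b ab]] := gend_rays_cofinal ws wr.
pose n := (i + j + d o u)%N; pose x := s (a + n)%N.
have rE m : r m = eray (omega0 T) m by apply: (ray_uniq tr wr (erayP _)); rewrite eray0.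
have zx l t t' : is_ray (@adj k T) t -> t l = z -> t (l + (t' - l))%N = x ->
    d (t 0%N) z = l /\ d z x = (t' - l)%N.
  move=> tt <- <-; rewrite (ray_dist tr _ _ tt); split=> //.
  exact: (ray_dist tr 0 l tt).
have [|uz zx1] := zx i s (a + n)%N sr si; first by rewrite subnKC// /n; lia.
have [|oz zx2] := zx j r (b + n)%N rr rj; first by rewrite subnKC ?/x ?ab// /n; lia.
rewrite (@end_height_eray _ (b + n)%N) -?rE -?ab; last by rewrite /n; lia.
have := ray_dist tr 0 (a + n)%N sr; rewrite add0n s0 => ->.
by move: uz oz zx1 zx2; rewrite s0 r0 /n => -> -> -> ?; lia.
Qed.

End Ends.

(** * Geodesics of the Diestel-Leader graph *)

Lemma horo_height k (T : marked_tree k) : horo (@adj k T) (@height k T).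
Proof.
have -> : @height k T = end_height (omega0 T) by apply/funext => u; exact: height_end_height.
exact: horo_end_height.
Qed.

(** A common descending path means that [F] and [G] point to the same end, so they differ by a
    constant. *)
Lemma horo_common_descent (V : choiceType) (e : rel V) (S : numDomainType)
    (F G : V -> S) (w : nat -> V) : is_tree e -> horo e F -> horo e G ->
  (forall i, e (w i) (w i.+1)) -> (forall i, F (w i) = F (w i.+1) + 1) ->
  (forall i, G (w i) = G (w i.+1) + 1) ->
  forall v, F v - G v = F (w 0%N) - G (w 0%N).
Proof.
move=> tr hF hG ew Fw Gw v; have [e_sym _ e_conn _] := tr.
(* The common descent can be restarted from a neighbour [u']: if [G] decreases, [u'] is the next
   vertex of [t] and [t] is shifted; if [G] increases, [F] has its smaller neighbour at [t 1] and
   increases too, and [u'] is prepended. *)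
pose P u := exists t : nat -> V, [/\ t 0%N = u, forall i, e (t i) (t i.+1),
  forall i, F (t i) = F (t i.+1) + 1, forall i, G (t i) = G (t i.+1) + 1
  & F u - G u = F (w 0%N) - G (w 0%N)].
suff step u u' : e u u' -> P u -> P u'.
  suff: P v by case=> ? [].
  have : P (w 0%N) by exists w.
  have [n] := e_conn (w 0%N) v; elim: n (w 0%N) => [|n IH] u; first by move=> /has_walk0 ->.
  by move=> /has_walkS[u1 euu1 u1v] /(step _ _ euu1); exact: IH.
move=> euu' [t [t0 et Ft Gt cst]].
have eut1 : e u (t 1%N) by rewrite -t0.
have [Gu|Gu] := hG.1 u u' euu'.
- have tu' : t 1%N != u'.
    apply/eqP => t1; have := Gt 0%N; rewrite t0 t1 Gu => /eqP.
    rewrite -addrA -{1}[G u]addr0 (inj_eq (addrI _)) eq_sym.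
    by rewrite -[1 + 1]/(2%:R) pnatr_eq0.
  have Fu : F u' = F u + 1.
    by apply: (hF.2 (t 1%N)) => //; rewrite 1?e_sym// -t0; exact: Ft.
  exists (fun i => if i is j.+1 then t j else u'); split=> //.
  + by case=> [|i] //; rewrite t0 e_sym.
  + by case=> [|i] //; rewrite t0.
  + by case=> [|i] //; rewrite t0.
  by rewrite Fu Gu -cst; ring.
- have tu' : u' = t 1%N.
    by apply: (horo_dec hG (b := u)) => //; rewrite -t0; exact: Gt.
  exists (fun i => t i.+1); split=> //.
  by rewrite -cst tu' -t0 (Ft 0%N) (Gt 0%N); ring.
Qed.

(** Minimality is stated against pairs of walks with opposite heights instead of a metric. This form
    is symmetric in the two factors, so each argument applies to either tree. *)
Definition dl_geodesic (V V' : choiceType) (e : rel V) (e' : rel V')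
    (h : V -> int) (h' : V' -> int) (x : int -> V) (x' : int -> V') :=
  [/\ forall m : int, e (x m) (x (m + 1)), forall m : int, e' (x' m) (x' (m + 1)),
      forall m, h (x m) + h' (x' m) = 0
    & forall (m n : int) (l : nat) (u : nat -> V) (u' : nat -> V'),
      (forall i, (i < l)%N -> e (u i) (u i.+1)) ->
      (forall i, (i < l)%N -> e' (u' i) (u' i.+1)) ->
      (forall i, (i <= l)%N -> h (u i) + h' (u' i) = 0) ->
      u 0%N = x m -> u' 0%N = x' m -> u l = x n -> u' l = x' n ->
      (`|m - n| <= l)%N].

Lemma dl_geodesic_sym (V V' : choiceType) (e : rel V) (e' : rel V') h h' x x' :
  dl_geodesic e e' h h' x x' -> dl_geodesic e' e h' h x' x.
Proof.
move=> [ex ex' hh short]; split=> // [m|m n l u u' eu eu' huu' u0 u'0 ul u'l].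
  by rewrite addrC.
by apply: (short m n l u' u) => // i il; rewrite addrC huu'.
Qed.

Section Turns.
Variables (V V' : choiceType) (e : rel V) (e' : rel V').
Variables (h : V -> int) (h' : V' -> int) (x : int -> V) (x' : int -> V').
Hypotheses (e_sym : symmetric e) (hh : horo e h) (gx : dl_geodesic e e' h h' x x').

(** Every vertex has at most one lower neighbour, so the two descents from the peak [x b] pass
    through the same vertices. *)
Lemma horo_reflect (b : int) (l : nat) :
  (forall i : nat, (i <= l)%N -> h (x (b - i%:Z)) = h (x b) - i%:Z) ->
  (forall i : nat, (i <= l)%N -> h (x (b + i%:Z)) = h (x b) - i%:Z) ->
  forall i : nat, (i <= l)%N -> x (b - i%:Z) = x (b + i%:Z).
Proof.
have [ex _ _ _] := gx; move=> hl hr; elim=> [|i IH] il; first by congr x; lia.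
have il' := ltnW il.
apply: (horo_dec hh (b := x (b - i%:Z))) => //.
- have := ex (b - i.+1%:Z); rewrite e_sym.
  by have -> : b - i.+1%:Z + 1 = b - i%:Z by lia.
- rewrite IH//; have := ex (b + i%:Z).
  by have -> : b + i%:Z + 1 = b + i.+1%:Z by lia.
- by rewrite !hl//; lia.
- by rewrite IH// !hr//; lia.
Qed.

End Turns.

Section Geodesic.
Variables (V V' : choiceType) (e : rel V) (e' : rel V').
Variables (h : V -> int) (h' : V' -> int) (x : int -> V) (x' : int -> V').
Hypotheses (e_sym : symmetric e) (e_sym' : symmetric e').
Hypotheses (hh : horo e h) (hh' : horo e' h') (gx : dl_geodesic e e' h h' x x').

(* x retraces its steps after a + l and x' retraces its steps after a, so that
   going down in x from a - l while going up in x' from a + l is a shortcut. *)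
Lemma no_zigzag (a : int) (l : nat) : (0 < l)%N ->
  (forall i : nat, (i <= l)%N -> h (x (a - i%:Z)) = h (x a) + i%:Z) ->
  (forall i : nat, (i <= l)%N -> h (x (a + i%:Z)) = h (x a) + i%:Z) ->
  (forall i : nat, (i <= l)%N -> h (x (a + l%:Z + i%:Z)) = h (x a) + l%:Z - i%:Z) ->
  False.
Proof.
move=> l0 hl hm hr; have [ex ex' hx short] := gx.
have h'x m : h' (x' m) = - h (x m) by have := hx m; lia.
have xref := horo_reflect e_sym hh gx (b := a + l%:Z) (l := l).
have x'ref := horo_reflect e_sym' hh' (dl_geodesic_sym gx) (b := a) (l := l).
have {}xref : x a = x (a + l%:Z + l%:Z).
  rewrite -xref//; last by move=> i il; rewrite hr// hm//.
    by congr x; lia.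
  move=> i il; have -> : a + l%:Z - i%:Z = a + (l - i)%N%:Z by lia.
  by rewrite !hm//; lia.
have {}x'ref : x' (a - l%:Z) = x' (a + l%:Z).
  by apply: x'ref => // i il; rewrite !h'x ?hl ?hm//; lia.
have : (`|((a - l%:Z) - (a + l%:Z + l%:Z))%R| <= l)%N; last by lia.
apply: (short _ _ l (fun i => x (a - l%:Z + i%:Z)) (fun i => x' (a + l%:Z + i%:Z))).
- by move=> i _; have := ex (a - l%:Z + i%:Z); congr e; congr x; lia.
- by move=> i _; have := ex' (a + l%:Z + i%:Z); congr e'; congr x'; lia.
- move=> i il; rewrite h'x hr//.
  have -> : a - l%:Z + i%:Z = a - (l - i)%N%:Z by lia.
  by rewrite hl; lia.
- by rewrite addr0.
- by rewrite addr0.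
- by rewrite -xref; congr x; lia.
- by [].
Qed.

End Geodesic.

Section GeodesicTurns.
Variables (V V' : choiceType) (e : rel V) (e' : rel V').
Variables (h : V -> int) (h' : V' -> int) (x : int -> V) (x' : int -> V').
Hypotheses (e_sym : symmetric e) (e_sym' : symmetric e').
Hypotheses (hh : horo e h) (hh' : horo e' h') (gx : dl_geodesic e e' h h' x x').

Definition ascends (m : int) := h (x (m + 1)) == h (x m) + 1.
Definition turns (m : int) := ascends (m - 1) != ascends m.
Local Notation up := ascends.
Local Notation turn := turns.

Lemma ascendsP m : h (x (m + 1)) = h (x m) + (if up m then 1 else - 1).
Proof.
rewrite /ascends; case: eqP => // no; have [ex _ _ _] := gx.
have [//|] : h (x (m + 1)) = h (x m) + 1 \/ h (x m) = h (x (m + 1)) + 1.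
  exact: hh.1.
by move=> /= ?; lia.
Qed.

Lemma ascends_run (b : int) (l : nat) s : (forall i : nat, (i < l)%N -> up (b + i%:Z) = s) ->
  forall i : nat, (i <= l)%N -> h (x (b + i%:Z)) = h (x b) + (if s then i%:Z else - i%:Z).
Proof.
move=> bs; elim=> [|i IH] il; first by rewrite addr0; case: s {bs}; lia.
have -> : b + i.+1%:Z = b + i%:Z + 1 by lia.
by rewrite ascendsP bs// IH 1?ltnW//; case: (s); lia.
Qed.

(** Strong induction on [l] excludes turns at smaller distance. The path is therefore monotone on
    the three consecutive stretches of length [l] from [a - l] to [a + 2l], which is the zigzag
    excluded before. *)
Lemma no_two_turns (a : int) (l : nat) : (0 < l)%N -> turn a -> turn (a + l%:Z) -> False.
Proof.
elim/ltn_ind: l a => l IH a l0 ta tal.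
have cst b : turn b -> (forall i : nat, (0 < i < l)%N -> ~ turn (b + i%:Z)) ->
    forall i : nat, (i < l)%N -> up (b + i%:Z) = up b.
  move=> tb ntb; elim=> [|i IHi] il; first by rewrite addr0.
  have /negP := ntb i.+1 il; rewrite negbK => /eqP <-.
  by rewrite -(IHi (ltnW il)); congr ascends; lia.
have nt b : turn b -> forall i : nat, (0 < i < l)%N -> ~ turn (b + i%:Z).
  by move=> tb i /andP[i0 il]; exact: IH.
have nt' b : turn b -> forall i : nat, (0 < i < l)%N -> ~ turn (b - i%:Z).
  move=> tb i /andP[i0 il] tbi; apply: (IH i il _ i0 tbi).
  by have -> : b - i%:Z + i%:Z = b by lia.
have mid := ascends_run (cst a ta (nt a ta)).
have right := ascends_run (cst _ tal (nt _ tal)).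
have leftup (i : nat) : (i < l)%N -> up (a - l%:Z + i%:Z) = up (a - 1).
  move=> il; have -> : a - l%:Z + i%:Z = a - 1 - (l - i.+1)%N%:Z by lia.
  have : (l - i.+1 < l)%N by lia.
  elim: (l - i.+1)%N => [|j IHj] jl; first by rewrite subr0.
  have /negP := nt' a ta j.+1 jl; rewrite negbK => /eqP uj.
  rewrite -(IHj (ltnW jl)); have -> : a - 1 - j%:Z = a - j.+1%:Z by lia.
  by rewrite -uj; congr ascends; lia.
have left := ascends_run leftup.
have upal : up (a + l%:Z - 1) = up a.
  have -> : a + l%:Z - 1 = a + l.-1%:Z by lia.
  by apply: (cst a ta (nt a ta)); lia.
move: (ta) (tal); rewrite /turns upal => ta' tal'.
have hla (i : nat) : (i <= l)%N ->
    h (x (a - i%:Z)) = h (x a) - (if up (a - 1) then i%:Z else - i%:Z).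
  move=> il; have := left l (leqnn l); have := left (l - i)%N (leq_subr _ _).
  have -> : a - l%:Z + (l - i)%N%:Z = a - i%:Z by lia.
  have -> : a - l%:Z + l%:Z = a by lia.
  by case: ifP; lia.
have mid' := mid l (leqnn l).
(* If [x] has its valley at [a], the zigzag is in [x]. If it has its peak there, [x'] has a valley,
   because its height is the opposite, and the roles are exchanged. *)
case ua: (up a) ta' tal' mid right hla mid'; case: (up (a - 1)) => // _;
    case: (up (a + _)) => //= _ mid right hla mid'; last first.
  have [_ _ hx _] := gx; have h'x m : h' (x' m) = - h (x m) by have := hx m; lia.
  apply: (no_zigzag e_sym' e_sym hh' hh (dl_geodesic_sym gx) (a := a) l0) => i il.
  - by rewrite !h'x hla//; lia.
  - by rewrite !h'x mid//; lia.
  - by rewrite !h'x right// mid'; lia.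
apply: (no_zigzag e_sym e_sym' hh hh' gx (a := a) l0) => i il.
- by rewrite hla//; lia.
- by rewrite mid//; lia.
- by rewrite right// mid'; lia.
Qed.

Lemma turn_uniq (a b : int) : turn a -> turn b -> a = b.
Proof.
move=> ta tb; apply/eqP; apply: contraT => ab; exfalso.
have [ltab|geab] := ltP a b.
  apply: (no_two_turns (a := a) (l := `|b - a|%N)) => //; first by lia.
  by have -> : a + `|b - a|%N%:Z = b by lia.
apply: (no_two_turns (a := b) (l := `|a - b|%N)) => //; first by lia.
by have -> : b + `|a - b|%N%:Z = a by lia.
Qed.

End GeodesicTurns.

(** * Linear growth of horofunctions along geodesics *)

Section Growth.
Variables (V V' : choiceType) (e : rel V) (e' : rel V') (S : realDomainType).
Variables (h : V -> int) (h' : V' -> int) (F : V -> S).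
Hypotheses (tr : is_tree e) (e_sym' : symmetric e').
Hypotheses (hh : horo e h) (hh' : horo e' h') (hF : horo e F).

Let e_sym : symmetric e. Proof. by case: tr. Qed.

Lemma horo_lipschitz (x : int -> V) (m : int) (n : nat) :
  (forall m : int, e (x m) (x (m + 1))) -> F (x (m + n%:Z)) - n%:R <= F (x m).
Proof.
move=> ex; elim: n => [|n IH]; first by rewrite subr0 [in m + _](_ : 0%:Z = 0)// addr0.
apply: le_trans IH; have := hF.1 _ _ (ex (m + n%:Z)).
have -> : m + n%:Z + 1 = m + n.+1%:Z by lia.
by rewrite -natr1; case=> ->; lra.
Qed.

Lemma linear_growth (x : int -> V) (c : int) : (forall m : int, e (x m) (x (m + 1))) ->
  (forall i : nat, F (x (c + i%:Z)) = F (x c) + i%:R) ->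
  exists C, forall n : nat, n%:R - C <= F (x n%:Z).
Proof.
(* This constant gives equality from [c] on. Before [c] it still works, because [F] changes by 1 at
   each step. *)
move=> ex lin; exists (c%:~R - F (x c)) => n; have [cn|nc] := leP c n%:Z.
  have [k nk] : exists k : nat, n%:Z = c + k%:Z by exists `|n%:Z - c|%N; lia.
  by rewrite nk lin -[n%:R]/(n%:Z%:~R) nk intrD -[k%:~R]/(k%:R); lra.
have [k nk] : exists k : nat, c = n%:Z + k%:Z by exists `|c - n%:Z|%N; lia.
have := horo_lipschitz n%:Z k ex; rewrite -nk {2}nk intrD.
by rewrite -[n%:Z%:~R]/(n%:R) -[k%:Z%:~R]/(k%:R); lra.
Qed.

(** If the height has a peak at [b], the half after [b] descends towards [omega0] forever: either
    [F] increases once, hence from then on, or it descends along with [h] and differs from it by a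
    constant. Without a peak [x] never backtracks, and the edge from [x 0] to [x 1] decides in which
    direction [F] grows. *)
Lemma geodesic_growth (x : int -> V) (x' : int -> V') :
  dl_geodesic e e' h h' x x' ->
  ~ (forall u v, F u - (h u)%:~R = F v - (h v)%:~R) ->
  (exists C, forall n : nat, n%:R - C <= F (x n%:Z)) \/
  (exists C, forall n : nat, n%:R - C <= F (x (- n%:Z))).
Proof.
move=> gx Fh; have [ex ex' hx short] := gx.
have hstep (m n : int) : n = m + 1 ->
    h (x n) = h (x m) + (if ascends h x m then 1 else - 1).
  by move=> ->; exact: ascendsP hh gx m.
have uniq := turn_uniq e_sym e_sym' hh hh' gx.
have exi (c : int) (i : nat) : e (x (c + i%:Z)) (x (c + i.+1%:Z)).
  by have -> : c + i.+1%:Z = c + i%:Z + 1 by lia.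
have [[b /andP[ub nub]]|nomax] :=
    pselect (exists b : int, ascends h x (b - 1) && ~~ ascends h x b).
  left; have tb : turns h x b by rewrite /turns ub (negbTE nub).
  have down (i : nat) : ascends h x (b + i%:Z) = false.
    elim: i => [|i IH]; first by rewrite addr0; apply/negbTE.
    apply: contraTF tb => ubi; have : turns h x (b + i.+1%:Z).
      rewrite /turns ubi; have -> : b + i.+1%:Z - 1 = b + i%:Z by lia.
      by rewrite IH.
    by move=> /uniq tu; apply/negP => /tu; lia.
  have hb (i : nat) : h (x (b + i%:Z)) = h (x b) - i%:Z.
    by apply: (ascends_run hh gx (b := b) (l := i) (s := false)) => // j _; exact: down.
  have [[i Fi]|noinc] := pselect (exists i : nat, F (x (b + i.+1%:Z)) = F (x (b + i%:Z)) + 1).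
    apply: (@linear_growth x (b + i%:Z)) => //.
    have := @horo_seq _ _ _ _ hF (fun j => x (b + i%:Z + j%:Z)) (exi _); rewrite addr0; apply.
      move=> j; apply/eqP => /(congr1 h).
      have -> : b + i%:Z + j%:Z = b + (i + j)%N%:Z by lia.
      have -> : b + i%:Z + j.+2%:Z = b + (i + j).+2%:Z by lia.
      by rewrite !hb; lia.
    have -> : b + i%:Z + 1%N%:Z = b + i.+1%:Z by lia. exact: Fi.
  case: Fh => u v.
  have := @horo_common_descent _ _ _ F (fun v => (h v)%:~R) (fun i => x (b + i%:Z)) tr hF
    (horo_int S hh) (exi b).
  have decF (i : nat) : F (x (b + i%:Z)) = F (x (b + i.+1%:Z)) + 1.
    by case: (hF.1 _ _ (exi b i)) => // Fi; case: noinc; exists i.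
  have dech (i : nat) : (h (x (b + i%:Z)))%:~R = (h (x (b + i.+1%:Z)))%:~R + 1 :> S.
    by rewrite -[1]/(1%:~R) -intrD !hb; congr (_%:~R); lia.
  by move=> /(_ decF dech) cst; rewrite !cst.
(* A backtrack of [x] without a peak is at a valley. There [x'] has a peak and backtracks too, so
   the geodesic would visit the same vertex twice. *)
have nb (m n l : int) : n = m + 1 -> l = n + 1 -> x m != x l.
  move=> nE lE; apply/eqP => xm; have := hstep n l lE; have := hstep m n nE.
  rewrite xm; case um: (ascends h x m) => /= hm1; case un: (ascends h x n) => /= hm2; try lia.
    by apply: nomax; exists n; rewrite un nE addrK um.
  have h'x j : h' (x' j) = - h (x j) by have := hx j; lia.
  have xm' : x' m = x' l.
    apply: (horo_dec hh' (b := x' n)) => //.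
    - by rewrite e_sym' nE.
    - by rewrite lE.
    - by rewrite !h'x xm; lia.
    - by rewrite !h'x; lia.
  have : (`|(m - l)%R| <= 0)%N; last by lia.
  by apply: (short m l 0%N (fun=> x m) (fun=> x' m)).
have [F1|F0] := hF.1 _ _ (ex 0).
  left; apply: (@linear_growth x 0) => //.
  have := @horo_seq _ _ _ _ hF (fun j => x (0 + j%:Z)) (exi _); rewrite addr0; apply.
    by move=> j; apply: (nb _ (0 + j.+1%:Z)); lia.
  by [].
right; have ey (m : int) : e (x (- m)) (x (- (m + 1))).
  by have := ex (- (m + 1)); rewrite e_sym; congr (e (x _) _); lia.
(* The reversed path is at [x 1] at time -1, so its first step is the increasing one, from [x 1] to
   [x 0]. *)
apply: (@linear_growth (fun m => x (- m)) (- 1)) => // i.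
have := @horo_seq _ _ _ _ hF (fun j => x (1 - j%:Z)).
have E : - (-1 + i%:Z) = 1 - i%:Z by lia.
rewrite E opprK subr0; apply.
- move=> j; have := ex (1 - j.+1%:Z); rewrite e_sym; congr (e (x _) _); lia.
- by move=> j; rewrite eq_sym; apply: (nb _ (1 - j.+1%:Z)); lia.
- exact: F0.
Qed.

End Growth.

(** A positive value of [gdist] is not the default 0, so it is realised by a walk. This makes
    consecutive vertices of a bi-infinite geodesic adjacent. *)
Lemma gdist_gt0_walk (V : choiceType) (e : rel V) x y :
  (0 < gdist e x y)%N -> has_walk e x y (gdist e x y).
Proof.
have [[n /gdist_walk[]//]|no] := pselect (exists n, has_walk e x y n).
by rewrite /gdist xgetPN// => n [xyn _]; apply: no; exists n.
Qed.

Lemma bigeodesic_dl_geodesic k k' (T : marked_tree k) (T' : marked_tree k')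
    (g : int -> DL T T') : bigeodesic (@DLadj _ _ T T') g ->
  dl_geodesic (@adj k T) (@adj k' T') (@height k T) (@height k' T')
    (fun m => (val (g m)).1) (fun m => (val (g m)).2).
Proof.
move=> bg; have adjg m : DLadj (g m) (g (m + 1)).
  apply/has_walk1; have := @gdist_gt0_walk _ (@DLadj _ _ T T') (g m) (g (m + 1)).
  rewrite bg; have -> : `|(m - (m + 1))%R|%N = 1%N by lia.
  exact.
split=> [m|m|m|m n l u u' eu eu' huu' u0 u'0 ul u'l].
- by have /andP[] := adjg m.
- by have /andP[] := adjg m.
- exact/eqP/(valP (g m)).
(* The default [DLroot] can occur only after index [l], where the heights are not known to
   cancel. *)
rewrite -(bg m n); pose z i : DL T T' := insubd (DLroot T T') (u i, u' i).
have zE i : (i <= l)%N -> val (z i) = (u i, u' i).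
  by move=> il; apply: insubdK; rewrite -topredE/=; apply/eqP/huu'.
have -> : g m = z 0%N by apply: val_inj; rewrite zE// u0 u'0; case: (val _).
have -> : g n = z l by apply: val_inj; rewrite zE// ul u'l; case: (val _).
by apply/gdist_le/has_walk_seq => i il; rewrite /DLadj !zE ?eu ?eu'// ltnW.
Qed.

(** * Harmonic measure of shadows *)

Section Neighbours.
Variables (k : nat) (T : marked_tree k).
Local Notation adjT := (@adj k T).
Local Notation d := (gdist adjT).
Local Notation o := (tree_root T).

Lemma neighbours_exist (x : T) :
  exists s : seq T, [/\ uniq s, size s = k & forall y, (y \in s) = adj x y].
Proof.
have Ak := @adj_regular k T x; exists (finmap.enum_fset (fset_set [set y | adj x y])).
split; [exact: finmap.fset_uniq|exact: card_fset_set|move=> y].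
have fin : finite_set [set y | adj x y] by apply/finite_setP; exists k.
by apply: etrans (in_fset_set fin y) _; apply/idP/idP; rewrite inE.
Qed.

Definition neighbours (x : T) : seq T := sval (cid (neighbours_exist x)).

Lemma neighbours_uniq x : uniq (neighbours x).
Proof. by rewrite /neighbours; case: cid => ? []. Qed.

Lemma size_neighbours x : size (neighbours x) = k.
Proof. by rewrite /neighbours; case: cid => ? []. Qed.

Lemma mem_neighbours x y : (y \in neighbours x) = adj x y.
Proof. by rewrite /neighbours; case: cid => ? []. Qed.

(** End points are listed with multiplicity, so that the length is exactly [k ^ n]. *)
Fixpoint walk_ends (n : nat) (x : T) : seq T :=
  if n is n'.+1 then flatten [seq walk_ends n' y | y <- neighbours x] else [:: x].

Lemma walk_endsP n x y : has_walk adjT x y n -> y \in walk_ends n x.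
Proof.
elim: n x => [|n IH] x; first by move=> /has_walk0 ->; rewrite mem_head.
move=> /has_walkS[z xz /IH zy]; apply/flattenP; exists (walk_ends n z) => //.
by apply: map_f; rewrite mem_neighbours.
Qed.

Lemma size_walk_ends n x : size (walk_ends n x) = (k ^ n)%N.
Proof.
elim: n x => [//|n IH] x; rewrite /= size_flatten /shape -map_comp.
rewrite (eq_map (g := fun=> (k ^ n)%N)); last by move=> y; exact: IH.
by rewrite sumnE big_map big_const_seq count_predT size_neighbours iter_addn_0 expnS mulnC.
Qed.

Lemma countable_vertices : countable [set: T].
Proof.
have -> : [set: T] = \bigcup_n [set` walk_ends n o].
  apply/seteqP; split=> // y _; have [_ _ conn _] := @adj_tree k T.
  by have [n oy] := conn o y; exists n => //; exact: walk_endsP.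
by apply: bigcup_countable => // n _; exact/finite_set_countable/finite_seq.
Qed.

End Neighbours.

(** * The transition operator of simple random walk and half-trees *)

Section RandomWalk.
Variables (R : realType) (p : nat) (T : marked_tree p.+1).
Hypothesis p2 : (2 <= p)%N.
Local Notation adjT := (@adj p.+1 T).
Local Notation d := (gdist adjT).
Local Notation o := (tree_root T).

Let tr := @adj_tree p.+1 T.
Let e_sym : symmetric adjT. Proof. by case: tr. Qed.
Let e_conn (x y : T) : exists n, has_walk adjT x y n. Proof. by case: tr. Qed.
Local Notation dC := (gdistC e_sym e_conn).
Local Notation d_tri := (gdist_tri e_conn).

Definition srw_avg (f : T -> R) (x : T) : R :=
  (\sum_(y <- neighbours x) f y) / p.+1%:R.

Lemma srw_avg_split (f : T -> R) x a c : adj x a ->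
  (forall y, adj x y -> y != a -> f y = c) -> srw_avg f x = (f a + p%:R * c) / p.+1%:R.
Proof.
move=> xa fc; congr (_ / _).
rewrite (bigD1_seq a) ?neighbours_uniq ?mem_neighbours//=; congr (_ + _).
rewrite big_seq_cond (eq_bigr (fun=> c)) -?big_seq_cond; last first.
  by move=> y /andP[]; rewrite mem_neighbours; exact: fc.
rewrite big_const_seq iter_addr_0 mulr_natl; congr (_ *+ _).
have := count_predC (pred1 a) (neighbours x).
rewrite (count_uniq_mem _ (neighbours_uniq x)) mem_neighbours xa size_neighbours.
by case.
Qed.

(** The operator fixes [u] and contracts the weight [g] by [rho], so the error [phi - u], dominated
    by [g], decays geometrically. *)
Lemma iter_avg_bound (phi u g : T -> R) (rho : R) : 0 <= rho ->
  (forall x, srw_avg u x = u x) -> (forall x, srw_avg g x <= rho * g x) ->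
  (forall x, `|phi x - u x| <= g x) ->
  forall n x, `|iter n srw_avg phi x - u x| <= rho ^+ n * g x.
Proof.
move=> rho0 hu hg hphi; elim=> [|n IH] x; first by rewrite expr0 mul1r.
rewrite iterS -[u x]hu -mulrBl -sumrB normrM [`|_^-1|]ger0_norm ?invr_ge0//.
rewrite ler_pdivrMr// (le_trans (ler_norm_sum _ _ _))//.
apply: (@le_trans _ _ (\sum_(y <- neighbours x) rho ^+ n * g y)); first exact: ler_sum.
rewrite -mulr_sumr exprSr -!mulrA ler_wpM2l ?exprn_ge0//.
by have := hg x; rewrite ler_pdivrMr// mulrA.
Qed.

Section Edge.
Variables a v : T.
Hypothesis av : adj a v.

Definition beyond x := d a x == (d v x).+1.
Local Notation S := beyond.

Lemma side_cases x : d a x = (d v x).+1 \/ d v x = (d a x).+1.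
Proof. by have [] := tree_edge_dist tr x av; rewrite !(dC x); [right|left]. Qed.

Lemma side_parent b x : adj b x -> d v x = (d v b).+1 -> S x -> S b.
Proof.
rewrite /beyond => bx vbx /eqP ax; apply/eqP; have := side_cases b.
have := tree_edge_dist tr a bx; rewrite ax vbx; lia.
Qed.

(** The half-tree can be left only by the step from [v] to [a], and [b] is not [v]. *)
Lemma side_child b x : adj b x -> d v x = (d v b).+1 -> b != v -> S b -> S x.
Proof.
rewrite /beyond => bx vbx bv /eqP ab; apply/eqP.
case vb: (d v b) => [|n]; first by rewrite ((gdist_eq0 e_conn v b).1 vb) eqxx in bv.
have [c bc vc] := gdist_pred e_sym e_conn vb.
have [? ?] := (side_cases c, tree_edge_dist tr a bc).
have cx : c != x by apply: contra_eq_neq vbx => <-; rewrite vc vb; lia.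
have acb : (d a b)%:R = (d a c)%:R + 1 :> int by rewrite natr1; congr _%:R; lia.
rewrite e_sym in bc; have /= := (horo_gdist tr int a).2 c b x bc bx cx acb.
by rewrite natr1 => /eqP; rewrite eqr_nat => /eqP; lia.
Qed.

(* The probability that the walk from x ends up beyond the edge a -- v. *)
Definition hit_prob x : R := if S x then 1 - p%:R ^- d v x / p.+1%:R
                   else p%:R * p%:R ^- d v x / p.+1%:R.

Local Notation harm := hit_prob.

Lemma hit_prob_root : ~~ S o -> harm o = p%:R * p%:R ^- d v o / p.+1%:R.
Proof. by rewrite /hit_prob => /negbTE ->. Qed.

Let p_neq0 : p%:R != 0 :> R. Proof. by rewrite pnatr_eq0; lia. Qed.
Let p1_neq0 : p%:R + 1 != 0 :> R. Proof. by rewrite natr1 pnatr_eq0. Qed.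

Let p1E : p.+1%:R = p%:R + 1 :> R. Proof. by rewrite natr1. Qed.

(** The formulas come from two facts: the walk reaches a given vertex at distance [n] with
    probability [p ^- n], and from a vertex it ends in each of the [p + 1] branches with equal
    probability. Here harmonicity is checked directly, at [v] and on both sides of the edge. *)
Lemma hit_prob_avg x : srw_avg harm x = harm x.
Proof.
have edge1 b c : adj b c -> d b c = 1%N.
  by move=> bc; have := tree_edge_dist tr b bc; rewrite gdistxx//; case.
have Sv : S v by rewrite /beyond gdistxx// edge1.
have Sa : S a = false by rewrite /beyond gdistxx.
case vx: (d v x) => [|n].
  have xv := (gdist_eq0 e_conn v x).1 vx; subst x.
  rewrite (@srw_avg_split _ v a (1 - p%:R^-1 / p.+1%:R)) 1?e_sym//; last first.
    move=> y vy ya; suff ay : d a y = 2%N by rewrite /hit_prob /beyond ay (edge1 v y vy).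
    have : (d a v)%:R = (d a a)%:R + 1 :> int by rewrite natr1 edge1// gdistxx.
    move=> /((horo_gdist tr int a).2 a v y av vy); rewrite eq_sym => /(_ ya).
    by rewrite natr1 (edge1 a v av) => /eqP; rewrite eqr_nat => /eqP.
  rewrite /hit_prob Sv Sa vx (edge1 v a) 1?e_sym// expr0 expr1 p1E.
  by field; rewrite p_neq0 p1_neq0.
have [b xb vb] := gdist_pred e_sym e_conn vx.
have bx : adj b x by rewrite e_sym.
have vbx : d v x = (d v b).+1 by rewrite vx vb.
have child y : adj x y -> y != b -> d v y = n.+2.
  move=> xy yb; have : (d v x)%:R = (d v b)%:R + 1 :> int by rewrite natr1 vbx.
  move=> /((horo_gdist tr int v).2 b x y bx xy); rewrite eq_sym => /(_ yb).
  by rewrite natr1 vx => /eqP; rewrite eqr_nat => /eqP.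
have xv : x != v by apply/eqP => xv; rewrite xv gdistxx in vx.
have [Sx|Sx] := boolP (S x).
  rewrite (@srw_avg_split _ x b (1 - p%:R ^- n.+2 / p.+1%:R))//; last first.
    by move=> y xy yb; rewrite /hit_prob (child y)// (@side_child x)// (child y) ?vx.
  rewrite /hit_prob (side_parent bx vbx Sx) Sx vx vb !exprS p1E.
  by field; rewrite expf_neq0 ?p_neq0 ?p1_neq0.
rewrite (@srw_avg_split _ x b (p%:R * p%:R ^- n.+2 / p.+1%:R))//; last first.
  move=> y xy yb; rewrite /hit_prob (child y)//; case: ifP => // Sy.
  by rewrite (side_parent xy) ?vx ?(child y)// in Sx.
(* Towards [v] the neighbour [b] is also outside the half-tree, unless it is [v] itself, where the
   two formulas agree. *)
have -> : harm b = p%:R * p%:R ^- n / p.+1%:R.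
  rewrite /hit_prob; case: ifP => Sb; last by rewrite vb.
  have [bv|bv] := eqVneq b v; last by rewrite (side_child bx vbx bv Sb) in Sx.
  rewrite bv gdistxx// in vb; rewrite bv gdistxx// -vb expr0 p1E.
  by field; rewrite p1_neq0.
rewrite /hit_prob (negbTE Sx) vx !exprS p1E.
by field; rewrite expf_neq0 ?p_neq0 ?p1_neq0.
Qed.

(** The contraction factor of the weight [t ^+ d v x] away from [v] is [(1/t + p t) / (p + 1)],
    which is below 1 exactly for [1/p < t < 1]; the choice [t = 3/4] serves every [p >= 2]. *)
Let rho : R := (4 / 3 + p%:R * (3 / 4)) / p.+1%:R.

Let p2R : 2 <= p%:R :> R. Proof. by rewrite (ler_nat R 2). Qed.

Lemma rho_bound : 0 <= rho < 1.
Proof.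
have p1 : 0 < p.+1%:R :> R by rewrite ltr0n.
have ? := p2R; rewrite /rho; apply/andP; split; first by rewrite divr_ge0//; lra.
by rewrite ltr_pdivrMr// mul1r p1E; lra.
Qed.

Let decay x : R := (3 / 4) ^+ d v x.

Lemma decay_avg x : srw_avg decay x <= rho * decay x.
Proof.
have p1 : 0 < p.+1%:R :> R by rewrite ltr0n.
have edge1 b c : adj b c -> d b c = 1%N.
  by move=> bc; have := tree_edge_dist tr b bc; rewrite gdistxx//; case.
case vx: (d v x) => [|n].
  have xv := (gdist_eq0 e_conn v x).1 vx; subst x.
  rewrite (@srw_avg_split _ v a (3 / 4)) 1?e_sym//.
    rewrite /decay vx (edge1 v a) 1?e_sym// /rho expr0 expr1 mulr1.
    by rewrite ler_pM2r ?invr_gt0//; have ? := p2R; lra.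
  by move=> y vy ya; rewrite /decay edge1.
have [b xb vb] := gdist_pred e_sym e_conn vx.
have bx : adj b x by rewrite e_sym.
rewrite (@srw_avg_split _ x b ((3 / 4) ^+ n.+2))//.
  rewrite /decay vb vx /rho -[leRHS]mulrAC ler_pM2r ?invr_gt0// !exprS.
  by rewrite le_eqVlt; apply/orP; left; apply/eqP; field.
move=> y xy yb; rewrite /decay; congr (_ ^+ _).
have : (d v x)%:R = (d v b)%:R + 1 :> int by rewrite natr1 vx vb.
move=> /((horo_gdist tr int v).2 b x y bx xy); rewrite eq_sym => /(_ yb).
by rewrite natr1 vx => /eqP; rewrite eqr_nat => /eqP.
Qed.

Lemma hit_prob_approx x : `|(S x)%:R - harm x| <= decay x.
Proof.
have p1 : 0 < p.+1%:R :> R by rewrite ltr0n.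
have pp : 0 < p%:R :> R by rewrite ltr0n; lia.
have pdecay : p%:R ^- d v x <= decay x.
  rewrite /decay -exprVn lerXn2r ?nnegrE ?invr_ge0//.
  rewrite (@le_trans _ _ 2^-1)//; last by lra.
  by rewrite lef_pV2 ?posrE.
have pos : 0 <= p%:R ^- d v x :> R by rewrite invr_ge0 exprn_ge0.
rewrite /hit_prob; case: ifP => _.
  rewrite subKr ger0_norm ?divr_ge0//; apply: le_trans pdecay.
  by rewrite ler_pdivrMr// ler_peMr// ler1n.
rewrite sub0r normrN ger0_norm ?divr_ge0 ?mulr_ge0//; apply: le_trans pdecay.
rewrite ler_pdivrMr// mulrC ler_wpM2l// ler_nat.
by [].
Qed.

(** The complement is treated as well because [srw_ge] bounds probabilities only from below; an
    upper bound comes from the complementary event. *)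
Lemma avg_side_limit x : exists2 eps : nat -> R, (eps n @[n --> \oo] --> 0)%R &
  forall n, `|iter n srw_avg (fun y => (S y)%:R) x - harm x| <= eps n /\
   `|iter n srw_avg (fun y => (~~ S y)%:R) x - (1 - harm x)| <= eps n.
Proof.
have [rho0 rho1] := andP rho_bound.
exists (fun n => rho ^+ n * decay x).
  rewrite -[X in _ --> X](mul0r (decay x)); apply: cvgMl.
  by apply: cvg_expr; rewrite ger0_norm.
move=> n; split.
  by apply: iter_avg_bound => //;
    [exact: hit_prob_avg|exact: decay_avg|exact: hit_prob_approx].
apply: (iter_avg_bound (u := fun x => 1 - harm x)) => //.
- move=> y; rewrite -[in RHS](hit_prob_avg y) /srw_avg sumrB mulrBl.
  rewrite big_const_seq iter_addr_0 count_predT size_neighbours.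
  by rewrite divff// pnatr_eq0.
- exact: decay_avg.
- move=> y; rewrite -normrN (le_trans _ (hit_prob_approx y))//.
  by case: (S y) => /=; rewrite le_eqVlt; apply/orP; left; apply/eqP; congr `|_|; ring.
Qed.

End Edge.

End RandomWalk.

Section MeasureLemmas.
Variables (R : realType) (D : measure_display) (Om : measurableType D).
Variable P : probability Om R.

Lemma sum_measure_le (I : eqType) (s : seq I) (F : I -> set Om) (E : set Om) :
  uniq s -> measurable E -> (forall i, measurable (F i)) ->
  (forall i, i \in s -> F i `<=` E) -> (forall i j, i != j -> F i `&` F j = set0) ->
  (\sum_(i <- s) P (F i) <= P E)%E.
Proof.
move=> us mE mF sF dF; elim: s E us mE sF => [|i s IH] E; first by rewrite big_nil.
rewrite cons_uniq => /andP[is_ us] mE sF; rewrite big_cons.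
have -> : P E = (P (F i) + P (E `\` F i))%E.
  rewrite -measureU ?setDIK//; last exact: measurableD.
  by rewrite setDUK//; apply: sF; rewrite mem_head.
rewrite leeD2l// IH//; first exact: measurableD.
move=> j js s0 Fj; split; first by apply: (sF j) => //; rewrite inE js orbT.
move=> Fi; have ij : i != j by apply: contraNneq is_ => ->.
by have : (F i `&` F j) s0 by []; rewrite dF.
Qed.

(** Fatou for sets: up to a null set [E] lies in the lower limit of the [F n]. *)
Lemma measure_ae_eventually (E : set Om) (F : nat -> set Om) (l : R) (eps : nat -> R) :
  measurable E -> (forall n, measurable (F n)) ->
  {ae P, forall s, E s -> \forall n \near \oo, F n s} ->
  (forall n, (P (F n) <= (l + eps n)%:E)%E) -> eps n @[n --> \oo] --> (0 : R) ->
  (P E <= l%:E)%E.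
Proof.
move=> mE mF [N [mN N0 sN]] PF eps0.
pose G m := \bigcap_(n in [set n | (m <= n)%N]) F n.
have mG m : measurable (G m) by apply: bigcap_measurableType => n _.
have mUG : measurable (\bigcup_m G m) by apply: bigcupT_measurable.
apply: (@le_trans _ _ (P ((\bigcup_m G m) `|` N))).
  apply: le_measure; rewrite ?inE//; first exact: measurableU.
  move=> s Es; have [Ns|Ns] := pselect (N s); [by right|left].
  have : E s -> \forall n \near \oo, F n s.
    by apply: contrapT => h; apply: Ns; apply: sN.
  by move=> /(_ Es)[m _ Hm]; exists m => // n; exact: Hm.
rewrite measureU0//.
have cvgG : P (G m) @[m --> \oo] --> P (\bigcup_m G m).
  apply: (@nondecreasing_cvg_mu _ _ _ P G) => // m n mn.
  by apply/subsetPset => s Gs j /= nj; apply: Gs => /=; exact: leq_trans nj.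
rewrite [leLHS](_ : _ = limn (P \o G)); last exact/esym/cvg_lim.
apply: lime_le; first by apply/cvg_ex; exists (P (\bigcup_m G m)).
near=> m => /=; have Gfin : P (G m) \is a fin_num by exact: fin_num_measure.
rewrite -(fineK Gfin) lee_fin; apply/ler_addgt0Pr => e e0.
have [n [mn en]] : exists n, (m <= n)%N /\ eps n < e.
  have := cvgr_lt 0 eps0 _ e0 => -[k _ Hk]; exists (maxn m k).
  by rewrite leq_maxl; split=> //; apply: Hk => /=; exact: leq_maxr.
rewrite -lee_fin (fineK Gfin); apply: (@le_trans _ _ (P (F n))).
  by apply: le_measure; rewrite ?inE// => s; apply.
by apply: le_trans (PF n) _; rewrite lee_fin lerD2l ltW.
Unshelve. all: by end_near.
Qed.

End MeasureLemmas.

Section HarmonicMeasure.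
Variables (R : realType) (p : nat) (T : marked_tree p.+1).
Hypothesis p2 : (2 <= p)%N.
Local Notation adjT := (@adj p.+1 T).
Local Notation d := (gdist adjT).
Local Notation o := (tree_root T).

Let tr := @adj_tree p.+1 T.

Section Walk.
Variables (D : measure_display) (Om : measurableType D) (P : probability Om R).
Variable X : nat -> Om -> T.
Hypothesis srwX : is_srw P X.

Let cyl m (x : nat -> T) := [set s | forall i, (i <= m)%N -> X i s = x i].

Let weight m (x : nat -> T) : R :=
  (x 0%N == o)%:R * \prod_(i < m) ((adj (x i) (x i.+1))%:R / p.+1%:R).

Lemma measurable_walk_pred n (B : pred T) : measurable [set s | B (X n s)].
Proof.
have -> : [set s | B (X n s)] =
    \bigcup_v (if B v then X n @^-1` [set v] else set0).
  apply/seteqP; split=> [s Bs|s [v _]]; first by exists (X n s); rewrite //= ifT.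
  by case: ifP => //= Bv ->.
apply: countable_bigcupT_measurable; first exact: countable_vertices.
by move=> v; case: ifP => // _; exact: srwX.1.
Qed.

Let measurable_cyl m x : measurable (cyl m x).
Proof.
have -> : cyl m x = \bigcap_(i in [set i | (i <= m)%N]) (X i @^-1` [set x i]) by [].
by apply: bigcap_measurableType => i _; exact: srwX.1.
Qed.

(** Induction on [n] over the vertex at time [m + 1]: the extensions of the cylinder by the
    neighbours of [x m] are disjoint, and each has [1 / (p + 1)] of its weight. *)
Lemma srw_cylinder_ge n m (x : nat -> T) (B : pred T) :
  ((weight m x * iter n (@srw_avg R p T) (fun y => (B y)%:R) (x m))%:E <=
   P (cyl m x `&` [set s | B (X (m + n)%N s)]))%E.
Proof.
elim: n m x => [|n IH] m x.
  rewrite addn0 /=; have [Bx|Bx] := boolP (B (x m)); last by rewrite mulr0.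
  rewrite mulr1 (_ : _ `&` _ = cyl m x) ?srwX.2//.
  by apply: setIidl => s /= /(_ m (leqnn m)) ->.
pose ext y := (fun i => if (i <= m)%N then x i else y).
pose F y := cyl m.+1 (ext y) `&` [set s | B (X (m.+1 + n)%N s)].
have extm y : ext y m.+1 = y by rewrite /ext ltnn.
have mF y : measurable (F y).
  by apply: measurableI => //; exact: measurable_walk_pred.
have mI : measurable (cyl m x `&` [set s | B (X (m + n.+1)%N s)]).
  by apply: measurableI => //; exact: measurable_walk_pred.
have weight_ext y : y \in neighbours (x m) -> weight m.+1 (ext y) = weight m x / p.+1%:R.
  rewrite mem_neighbours => xy; rewrite /weight big_ord_recr /= mulrA /ext leqnn ltnn xy.
  rewrite div1r; congr (_ * _ / _); apply: eq_bigr => i _.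
  by rewrite (ltnW (ltn_ord i)) ltn_ord.
apply: le_trans (sum_measure_le P (neighbours_uniq (x m)) mI mF _ _); first last.
- move=> y z yz; apply/seteqP; split=> // s [[cy _] [cz _]].
  have := cy m.+1 (leqnn _); have := cz m.+1 (leqnn _); rewrite !extm => -> zy.
  by rewrite zy eqxx in yz.
- move=> y _ s [cs Bs]; split; last by rewrite /= addnS -addSn.
  by move=> i im; rewrite cs ?leqW// /ext im.
rewrite iterS /srw_avg mulrA mulr_sumr mulr_suml -sumEFin.
rewrite big_seq [leRHS]big_seq; apply: lee_sum => y ys.
apply: le_trans (IH m.+1 (ext y)); rewrite weight_ext// extm lee_fin.
by rewrite mulrAC.
Qed.

Lemma srw_ge n (B : pred T) :
  ((iter n (@srw_avg R p T) (fun y => (B y)%:R) o)%:E <= P [set s | B (X n s)])%E.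
Proof.
have := srw_cylinder_ge n 0 (fun=> o) B.
rewrite /weight eqxx big_ord0 !mul1r add0n => /le_trans; apply.
apply: le_measure; rewrite ?inE; last by move=> s [].
  by apply: measurableI => //; exact: measurable_walk_pred.
exact: measurable_walk_pred.
Qed.

End Walk.

Lemma measurable_shadow (v : T) : measurable ([set w | geod_end o w v] : set (boundary T)).
Proof. by apply: sub_sigma_algebra; exists v. Qed.

Lemma harmonic_shadow (eta : probability (boundary T) R) (a v : T) :
  is_harmonic_measure eta -> adj a v -> d o v = (d o a).+1 ->
  eta [set w | geod_end o w v] = (p%:R * p%:R ^- d o v / p.+1%:R)%:E.
Proof.
move=> [D [Om [P [X [Xoo [srwX mXoo lim etaE]]]]]] av ov.
have [e_sym _ e_conn _] := tr.
rewrite etaE; last exact: measurable_shadow.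
rewrite /pushforward; set E := Xoo @^-1` _.
have mE : measurable E.
  by rewrite -[E]setTI; apply: mXoo => //; exact: measurable_shadow.
have ho : hit_prob R a v o = p%:R * p%:R ^- d o v / p.+1%:R.
  rewrite hit_prob_root ?(gdistC e_sym e_conn v)// /beyond.
  by rewrite (gdistC e_sym e_conn a) (gdistC e_sym e_conn v) ov; lia.
rewrite -ho; have [eps eps0 bound] := avg_side_limit R p2 av o.
have beyondP x : beyond a v x <-> geod adjT o x v.
  by rewrite /beyond (geod_side tr x av ov); split=> [/eqP|?] //; apply/eqP.
have geodv w n x : (d o v <= n)%N -> geod adjT o x (eray w n) ->
    beyond a v x <-> geod_end o w v.
  by move=> vn xn; rewrite beyondP (sub_shadow vn xn) geod_endP.
(* Convergence to the end puts the walk eventually behind the ray vertex at the depth of [v]; from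
   then on its side of the edge tells whether the limit is in the shadow. *)
have cvX : {ae P, forall s, \forall n \near \oo,
    geod adjT o (X n s) (eray (Xoo s) (d o v))}.
  apply: filterS lim => s cv.
  apply: (cv [set x | geod adjT o x (eray (Xoo s) (d o v))]).
  exists (eray (Xoo s) (d o v)) => //; by apply/geod_endP; rewrite depth_eray.
have mB n : measurable [set s | beyond a v (X n s)].
  exact: (measurable_walk_pred srwX n (beyond a v)).
have upper : (P E <= (hit_prob R a v o)%:E)%E.
  apply: (@measure_ae_eventually _ _ _ P E
    (fun n => [set s | beyond a v (X n s)]) _ eps) => //.
    apply: filterS cvX => s cvs Es; apply: filterS cvs => n ns.
    exact/(geodv _ _ _ (leqnn _) ns).
  move=> n; have := srw_ge srwX n (predC (beyond a v)); rewrite /=.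
  have -> : [set s | ~~ beyond a v (X n s)] = ~` [set s | beyond a v (X n s)].
    by apply/seteqP; split=> s /= /negP.
  rewrite probability_setC//; have Bfin : P [set s | beyond a v (X n s)] \is a fin_num.
    exact: fin_num_measure.
  rewrite -(fineK Bfin) -EFinB !lee_fin; have [_] := bound n.
  by rewrite ler_norml => /andP[? _] ?; lra.
(* The lower bound for [P E] is obtained as an upper bound for the complement, by the same Fatou
   argument. *)
have lower : (P (~` E) <= (1 - hit_prob R a v o)%:E)%E.
  apply: (@measure_ae_eventually _ _ _ P (~` E)
    (fun n => ~` [set s | beyond a v (X n s)]) _ eps) => //.
  - exact: measurableC.
  - by move=> n; exact: measurableC.
  - apply: filterS cvX => s cvs Es; apply: filterS cvs => n ns.
    by move=> /(geodv _ _ _ (leqnn _) ns).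
  move=> n; have := srw_ge srwX n (beyond a v).
  rewrite probability_setC//; have Bfin : P [set s | beyond a v (X n s)] \is a fin_num.
    exact: fin_num_measure.
  rewrite -(fineK Bfin) -EFinB !lee_fin; have [+ _] := bound n.
  by rewrite ler_norml => /andP[? _] ?; lra.
have Efin : P E \is a fin_num by exact: fin_num_measure.
move: upper lower; rewrite probability_setC// -(fineK Efin) -EFinB !lee_fin => u l.
by congr EFin; apply/eqP; rewrite eq_le u/=; lra.
Qed.

End HarmonicMeasure.

(** * Measurability of horofunctions *)

Lemma geometric_le_eq0 (R : realType) (x : \bar R) (M r : R) :
  0 <= r < 1 -> (0 <= x)%E -> (forall n : nat, (x <= (M * r ^+ n)%:E)%E) -> x = 0%E.
Proof.
move=> /andP[r0 r1] x0 xle; have xfin : x \is a fin_num.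
  by rewrite ge0_fin_numE//; apply: le_lt_trans (xle 0%N) (ltry _).
apply/eqP; rewrite eq_le x0 andbT -(fineK xfin) lee_fin.
have lim : (M * r ^+ n) @[n --> \oo] --> (0 : R).
  rewrite -[X in _ --> X](mulr0 M); apply: cvgMr.
  by apply: cvg_expr; rewrite ger0_norm.
rewrite -(cvg_lim _ lim)//; apply: limr_ge; first by apply/cvg_ex; exists 0.
by near=> n; rewrite -lee_fin (fineK xfin).
Unshelve. all: by end_near.
Qed.

Lemma exponential_decay (R : realType) (K p : nat) (c : R) :
  (0 < K)%N -> (2 <= p)%N -> 0 < c ->
  exists M, forall m : nat, K%:R ^+ m * expR (- (c * p%:R ^+ m)) <= M * 2^-1 ^+ m.
Proof.
(* With [N + 1 = 2K], one Taylor term gives [expR (- x) <= (N + 1)! / x ^ (N + 1)], and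
   [2K <= p ^ (2K)] leaves the factor [2 ^ -m]. *)
move=> K0 p2 c0; pose N := (K.*2.-1)%N; exists (N.+1`!%:R / c ^+ N.+1) => m.
have pm : 0 < p%:R ^+ m :> R by rewrite exprn_gt0// ltr0n; lia.
have x0 : 0 < c * p%:R ^+ m by rewrite mulr_gt0.
have f0 : 0 < N.+1`!%:R :> R by rewrite ltr0n fact_gt0.
have le1 : expR (- (c * p%:R ^+ m)) <= N.+1`!%:R / (c * p%:R ^+ m) ^+ N.+1.
  rewrite expRN -[leRHS]invf_div lef_pV2 ?posrE ?expR_gt0 ?divr_gt0 ?exprn_gt0//.
  by apply: le_trans (expR_ge1Dxn N (ltW x0)); rewrite lerDr.
apply: le_trans (ler_wpM2l _ le1) _; first by rewrite exprn_ge0.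
have KN : (K * 2 <= p ^ N.+1)%N.
  have -> : (K * 2 = N.+1)%N by rewrite /N; lia.
  by apply/ltnW/ltn_expl.
have -> : K%:R ^+ m * (N.+1`!%:R / (c * p%:R ^+ m) ^+ N.+1) =
    N.+1`!%:R / c ^+ N.+1 * (K%:R / p%:R ^+ N.+1) ^+ m :> R.
  rewrite [(c * _) ^+ _]exprMn [(K%:R / _) ^+ m]exprMn exprVn -!exprM [(m * _)%N]mulnC.
  by rewrite invfM; ring.
apply: ler_wpM2l; first by rewrite divr_ge0 ?exprn_ge0 ?ltW.
apply: lerXn2r; rewrite ?nnegrE ?divr_ge0 ?exprn_ge0 ?invr_ge0//.
rewrite ler_pdivrMr ?exprn_gt0 ?ltr0n//; last by lia.
by rewrite mulrC ler_pdivlMr// -natrX -natrM ler_nat.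
Qed.

Section HoroSpace.
Variables (R : realType) (k k' : nat) (T : marked_tree k) (T' : marked_tree k').
Local Notation horo_space := (horospace T T' R).

Lemma countable_DL : countable [set: DL T T'].
Proof.
have /countable_injP[f inj] := countableX (countable_vertices T) (countable_vertices T').
apply/countable_injP; exists (f \o val) => z1 z2 _ _ /= fz.
by apply: val_inj; apply: inj fz; rewrite inE.
Qed.

Lemma measurable_eval (z : DL T T') :
  measurable_fun setT (fun th : horo_space => th z).
Proof.
move=> _ B mB; rewrite setTI; apply: sub_sigma_algebra.
by exists z, B.
Qed.

Lemma measurable_eval_diff (z1 z2 : DL T T') (r : R) :
  measurable [set th : horo_space | th z1 - th z2 = r].
Proof.
have -> : [set th : horo_space | th z1 - th z2 = r] =
    setT `&` (fun th : horo_space => th z1 - th z2) @^-1` [set r].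
  by rewrite setTI.
by apply: measurable_funB => //; exact: measurable_eval.
Qed.

Lemma measurable_forall (J : Type) (Q : J -> horo_space -> Prop) :
  countable [set: J] -> (forall j, measurable [set th | Q j th]) ->
  measurable [set th | forall j, Q j th].
Proof.
move=> cJ mQ; have -> : [set th | forall j, Q j th] = ~` \bigcup_j ~` [set th | Q j th].
  rewrite setC_bigcup; apply/seteqP; split=> [th H j _|th H j]; rewrite ?setCK//.
  by have := H j I; rewrite setCK.
apply: measurableC; apply: countable_bigcupT_measurable => // j.
exact: measurableC.
Qed.

Lemma measurable_implies (A : Prop) (Q : horo_space -> Prop) :
  measurable [set th | Q th] -> measurable [set th | A -> Q th].
Proof.
move=> mQ; have [a|na] := pselect A.
  suff -> : [set th | A -> Q th] = [set th | Q th] by [].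
  by apply/seteqP; split=> [th /(_ a)|th Qth _].
have -> : [set th | A -> Q th] = setT by apply/seteqP; split=> // th _ /na.
exact: measurableT.
Qed.

Section Good.
Variables (V : choiceType) (e : rel V) (h : V -> int).
Variables (pr : DL T T' -> V) (lft : V -> DL T T').
Hypothesis cV : countable [set: V].

(* The last clause excludes horofunctions equal to the height up to a constant,
   that is, those of omega0. *)
Definition good_horo : set horo_space := [set th | [/\ forall z, th z = th (lft (pr z)),
  horo e (fun v => th (lft v)) &
  ~ (forall u v, th (lft u) - (h u)%:~R = th (lft v) - (h v)%:~R)]].

(** Each clause is a countable combination of conditions fixing the difference of two
    evaluations. *)
Lemma measurable_good_horo : measurable good_horo.
Proof.
have eqE (z1 z2 : DL T T') (r : R) (th : horo_space) :
    th z1 = th z2 + r <-> th z1 - th z2 = r.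
  by split=> [->|<-]; ring.
have -> : good_horo = [set th | forall z, [set th | th z - th (lft (pr z)) = 0] th] `&`
   [set th | forall a b, (e a b -> [set th | th (lft b) - th (lft a) = 1] th \/
       [set th | th (lft a) - th (lft b) = 1] th)] `&`
   [set th | forall a b c, e a b -> e b c -> a != c ->
      ((~` [set th | th (lft b) - th (lft a) = 1]) th \/
       [set th | th (lft c) - th (lft b) = 1] th)] `&`
   ~` [set th | forall u v, [set th | th (lft u) - th (lft v) = (h u)%:~R - (h v)%:~R] th].
  apply/seteqP; split=> [th [H1 [H2 H3] H4]|th [[[H1 H2] H3] H4]].
    split; [split; [split|]|].
    - by move=> z /=; rewrite {1}H1 subrr.
    - by move=> a b /H2[/eqE|/eqE]; [left|right].
    - move=> a b c eab ebc ac; have [|] := pselect (th (lft b) - th (lft a) = 1); last by left.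
      by move=> /eqE/(H3 _ _ _ eab ebc ac)/eqE; right.
    - by move=> H; apply: H4 => u v; have /= E := H u v; lra.
  split.
  - by move=> z; apply/eqP; rewrite -subr_eq0; apply/eqP/H1.
  - split=> [a b /H2[/eqE|/eqE]|a b c eab ebc ac /eqE ab]; [by left|by right|].
    by have [/(_ ab)[]|/eqE] := H3 a b c eab ebc ac.
  - by move=> H; apply: H4 => u v /=; have /= E := H u v; lra.
apply: measurableI; last first.
  apply: measurableC; apply: measurable_forall => // u; apply: measurable_forall => // v.
  exact: measurable_eval_diff.
apply: measurableI.
  apply: measurableI.
    by apply: measurable_forall => [|z]; [exact: countable_DL|exact: measurable_eval_diff].
  apply: measurable_forall => // a; apply: measurable_forall => // b.
  by apply: measurable_implies; apply: measurableU; exact: measurable_eval_diff.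
apply: measurable_forall => // a; apply: measurable_forall => // b.
apply: measurable_forall => // c; do 3!apply: measurable_implies.
by apply: measurableU; [apply: measurableC|]; exact: measurable_eval_diff.
Qed.

End Good.
End HoroSpace.

(** The ray to [omega0] gives the heights at most 0. Upwards, of two neighbours of a vertex at most
    one is lower. *)
Lemma height_surj k (T : marked_tree k) (n : int) : (2 <= k)%N -> exists v : T, height v = n.
Proof.
move=> k2; have [e_sym _ _ _] := @adj_tree k T.
have neg (m : nat) : exists v : T, height v = - m%:Z.
  exists (eray (omega0 T) m); rewrite height_end_height.
  by rewrite (end_height_shadow _ _).2 ?depth_eray//; apply/geod_endP; rewrite depth_eray.
case: (intP n) => [|m|m]; [exact: (neg 0%N)| |exact: (neg m.+1)].
elim: m.+1 => [|{}m [v vm]]; first exact: (neg 0%N).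
have hT := @horo_height k T.
have := neighbours_uniq v; have := size_neighbours v; have := @mem_neighbours k T v.
case: (neighbours v) => [|a [|b s]] mem /= sz; [lia|lia|].
rewrite /= inE negb_or => /andP[/andP[ab _] _].
have [va vb] : adj v a /\ adj v b by rewrite -!mem !inE !eqxx orbT.
case: (hT.1 v a va) => [ha|ha]; first by exists a; rewrite ha vm; lia.
case: (hT.1 v b vb) => [hb|hb]; first by exists b; rewrite hb vm; lia.
by move: ab; rewrite (horo_dec hT va vb e_sym ha hb) eqxx.
Qed.

Section BoundaryHoro.
Variables (R : realType) (k1 k2 p : nat) (T1 : marked_tree k1) (T2 : marked_tree k2).
Variables (T : marked_tree p.+1) (pr : DL T1 T2 -> T) (lft : T -> DL T1 T2).
Hypotheses (p2 : (2 <= p)%N) (lftK : cancel lft pr).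
Local Notation o := (tree_root T).
Local Notation d := (gdist (@adj p.+1 T)).

Definition boundary_horo (w : boundary T) : horospace T1 T2 R :=
  fun z => busemann R w (pr z).
Local Notation f := boundary_horo.

Lemma measurable_end_height (y : T) :
  measurable_fun setT (fun w : boundary T => (end_height w y)%:~R : R).
Proof.
have [e_sym _ e_conn _] := @adj_tree _ T.
move En: (d o y) => n; elim: n y En => [|n IH] c cn.
  have <- := (gdist_eq0 e_conn o c).1 cn.
  by under eq_fun do rewrite end_height_root; exact: measurable_cst.
have [a ca an] := gdist_pred e_sym e_conn cn; rewrite e_sym in ca.
have -> : (fun w : boundary T => (end_height w c)%:~R : R) =
    (fun w => (end_height w a)%:~R + (1 - 2 * \1_[set w : boundary T | geod_end o w c] w)).
  apply/funext => w; rewrite (end_height_pred _ ca) ?cn ?an// intrD.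
  congr (_ + _); rewrite indicE; case: asboolP => h.
    by rewrite mem_set// rmorphB rmorphM.
  by rewrite memNset// rmorphB rmorphM.
apply: measurable_funD; first exact: IH.
apply: measurable_funB => //; apply: measurable_funM => //.
apply: measurable_indic; exact: measurable_shadow.
Qed.

Lemma measurable_boundary_horo : measurable_fun setT f.
Proof.
apply: measurability => // _ [_ [z [B [mB ->]]] <-].
rewrite /boundary_horo; have := measurable_end_height (pr z) measurableT mB.
congr measurable; apply/seteqP; split=> w [_ /= fz]; split=> //=.
  by rewrite busemann_end_height.
by rewrite -busemann_end_height.
Qed.

Definition good_boundary : set (horospace T1 T2 R) :=
  good_horo (@adj _ T) (@height _ T) pr lft.
Local Notation G := good_boundary.

Lemma measurable_good_boundary : measurable G.
Proof. by apply: measurable_good_horo; exact: countable_vertices. Qed.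

(** A horofunction equal to the height up to a constant takes its least possible value [- n] at
    [eray (omega0 T) n], which puts [w] in the shadow of that vertex. *)
Lemma boundary_horo_good (w : boundary T) n : ~ geod_end o w (eray (omega0 T) n) -> G (f w).
Proof.
move=> wn; have fE z : f w z = (end_height w (pr z))%:~R by exact: busemann_end_height.
split; first by move=> z; rewrite !fE lftK.
  rewrite (_ : (fun v => f w (lft v)) = (fun v => (end_height w v)%:~R)).
    exact/horo_int/horo_end_height.
  by apply/funext => v; rewrite fE lftK.
move=> H; apply: wn; apply/end_height_shadow; rewrite depth_eray.
have /eqP := H (eray (omega0 T) n) o; rewrite !fE !lftK !height_end_height !end_height_root.
rewrite subrr subr_eq0 eqr_int => /eqP ->.
have := (end_height_shadow (omega0 T) (eray (omega0 T) n)).2; rewrite depth_eray; apply.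
by apply/geod_endP; rewrite depth_eray.
Qed.

Lemma depth_eray_pred (w : tree_end T) n : adj (eray w n) (eray w n.+1) /\
  d o (eray w n.+1) = (d o (eray w n)).+1.
Proof. by rewrite !depth_eray; split=> //; exact: (eray_ray w).2. Qed.

(** The bad ends lie in every shadow along the ray to [omega0], and the measures of these shadows
    decrease geometrically. *)
Lemma harmonic_good_null (eta : probability (boundary T) R) : is_harmonic_measure eta ->
  eta (f @^-1` (~` G)) = 0%E.
Proof.
move=> heta; have mfG : measurable (f @^-1` (~` G)).
  rewrite -[X in measurable X]setTI; apply: measurable_boundary_horo => //.
  by apply: measurableC; exact: measurable_good_boundary.
have p0 : 0 < p%:R :> R by rewrite ltr0n; lia.
apply: (@geometric_le_eq0 _ _ (p.+1%:R^-1) p%:R^-1) => //.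
  by rewrite invr_ge0 ltW//= invf_lt1// ltr1n.
move=> n; have [e1 e2] := depth_eray_pred (omega0 T) n.
apply: (@le_trans _ _ (eta [set w | geod_end o w (eray (omega0 T) n.+1)])).
  apply: le_measure; rewrite ?inE//; first exact: measurable_shadow.
  by move=> w /= nG; apply: contrapT => /boundary_horo_good.
rewrite (harmonic_shadow p2 heta e1 e2) depth_eray lee_fin exprS exprVn.
rewrite le_eqVlt; apply/orP; left; apply/eqP.
by field; rewrite expf_neq0 ?gt_eqF// natr1 pnatr_eq0.
Qed.

(** The bound is an equality except at the root, whose shadow is the whole boundary, of measure 1
    instead of [p / (p + 1)]. *)
Lemma harmonic_shadow_ge (eta : probability (boundary T) R) (z : DL T1 T2) :
  is_harmonic_measure eta ->
  ((p%:R / p.+1%:R * p%:R ^- d o (pr z))%:E <=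
   eta (f @^-1` [set th | (th z <= - (d o (pr z))%:R)%R]))%E.
Proof.
move=> heta; have [e_sym _ e_conn _] := @adj_tree _ T; set y := pr z.
have -> : f @^-1` [set th | (th z <= - (d o y)%:R)%R] = [set w | geod_end o w y].
  apply/seteqP; split=> w /=; rewrite /boundary_horo busemann_end_height -/y.
    rewrite -[(d o y)%:R]/((d o y)%:Z%:~R) -intrN ler_int => wy.
    by apply/end_height_shadow; move: wy; rewrite /end_height; lia.
  by move=> /end_height_shadow ->; rewrite intrN.
case yn: (d o y) => [|n].
  have <- := (gdist_eq0 e_conn o y).1 yn.
  have -> : [set w : boundary T | geod_end o w o] = setT.
    by apply/seteqP; split=> // w _; apply/geod_endP; rewrite gdistxx// eray0.
  rewrite probability_setT lee_fin expr0 invr1 mulr1 ler_pdivrMr// mul1r ler_nat.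
  by [].
have [a ya an] := gdist_pred e_sym e_conn yn; rewrite e_sym in ya.
by rewrite (harmonic_shadow p2 heta ya) ?yn ?an// lee_fin mulrAC.
Qed.

End BoundaryHoro.

(** * The Poisson process *)

Section PoissonVoid.
Variables (R : realType) (D D' : measure_display) (Om : measurableType D).
Variables (E : measurableType D') (P : probability Om R).

Lemma npoints_eq0 (Z : nat -> Om -> E) (A : set E) (s : Om) :
  npoints R Z A s = 0%:R%:E <-> forall n, ~ A (Z n s).
Proof.
rewrite /npoints /counting; split=> [|H]; last first.
  have -> : [set n | A (Z n s)] = set0 by apply/seteqP; split=> n //= /H.
  by rewrite asboolT// fset_set0.
case: asboolP => // fin /eqP.
rewrite eqe eqr_nat finmap.cardfs_eq0 => /eqP/(fset_set_set0 fin) A0 n An.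
by have : [set n | A (Z n s)] n by []; rewrite A0.
Qed.

Lemma poisson_void mu (Z : nat -> Om -> E) (A : set E) :
  is_poisson_process P mu Z -> measurable A -> mu A \is a fin_num ->
  P [set s | forall n, ~ A (Z n s)] = (expR (- fine (mu A)))%:E.
Proof.
move=> [_ pois _ _] mA fA; have := pois A mA fA 0%N.
rewrite /poisson_weight expr0 fact0 divr1 mul1r => <-; congr (P _).
by apply/seteqP; split=> s /= /(npoints_eq0 Z A s).
Qed.

Lemma union_bound (I : Type) (s : seq I) (F : I -> set Om) (b : R) :
  (forall i, measurable (F i)) -> (forall i, (P (F i) <= b%:E)%E) ->
  (P (\big[setU/set0]_(i <- s) F i) <= ((size s)%:R * b)%:E)%E.
Proof.
move=> mF Fb; elim: s => [|i s IH]; first by rewrite big_nil measure0 mul0r.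
have mU : measurable (\big[setU/set0]_(j <- s) F j) by apply: bigsetU_measurable.
rewrite big_cons; apply: le_trans (measureU2 _ (mF i) mU) _.
have -> : ((size (i :: s))%:R * b)%:E = (b%:E + ((size s)%:R * b)%:E)%E.
  by rewrite -EFinD /= -natr1 mulrDl mul1r addrC.
exact: (leeD (Fb i) IH).
Qed.

End PoissonVoid.

Section Intensity.
Variables (R : realType) (k k' : nat) (T : marked_tree k) (T' : marked_tree k').
Variables (p q : nat) (eta : probability (boundary T) R) (eta' : probability (boundary T') R).
Variable xi : R.
Hypothesis p1 : (1 <= p)%N.
Local Notation nu0 := (nu0 p q eta eta').
Local Open Scope ereal_scope.

Lemma nu0_ge0 (B : set (horospace T T' R)) : 0 <= nu0 B.
Proof.
rewrite /nu0 /pushforward; case: ifP => _; first exact: measure_ge0.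
by apply: mule_ge0; rewrite ?lee_fin ?invr_ge0// adde_ge0.
Qed.

(** The factor 1/2 covers both cases of [nu0], so ends of [T] always supply the competing nuclei. *)
Lemma nu0_ge (B : set (horospace T T' R)) :
  (2^-1)%:E * eta (@rhoT _ _ T T' R @^-1` B) <= nu0 B.
Proof.
rewrite /nu0 /pushforward; case: ifP => _; last by rewrite lee_pmul2l// leeDl.
rewrite -[leRHS]mul1e lee_wpmul2r// lee_fin; lra.
Qed.

Lemma nu0_eq0 (B : set (horospace T T' R)) :
  eta (@rhoT _ _ T T' R @^-1` B) = 0 -> eta' (@rhoT' _ _ T T' R @^-1` B) = 0 -> nu0 B = 0.
Proof. by rewrite /nu0 /pushforward => -> ->; case: ifP => // _; rewrite adde0 mule0. Qed.

Lemma intensity_layer (B : set (horospace T T' R)) (i : int) :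
  intensity p q eta eta' xi (B `*` [set i]) = (beta_xi p xi i)%:E * nu0 B.
Proof.
have beta0 : 0 <= (beta_xi p xi i)%:E.
  by rewrite lee_fin mulr_ge0 ?powR_ge0// subr_ge0 ler1n.
rewrite /intensity -(@esum_set1 _ _ i (fun j => (beta_xi p xi j)%:E * nu0 B)).
  rewrite [RHS]esum_mkcond; apply: eq_esum => j _; case: ifPn => ji.
    congr (_ * nu0 _); apply/seteqP; split=> th /=; first by case.
    by split=> //; exact: set_mem ji.
  rewrite (_ : [set th | _] = set0); last first.
    by apply/seteqP; split=> th //= [_ /= ij]; case/negP: ji; rewrite ij; exact/mem_set.
  by rewrite nu0_eq0 ?mule0// preimage_set0 measure0.
by rewrite mule_ge0 ?nu0_ge0.
Qed.

Lemma intensity_null (B : set (horospace T T' R)) : nu0 B = 0 ->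
  intensity p q eta eta' xi (B `*` setT) = 0.
Proof.
move=> B0; rewrite /intensity esum1// => i _.
rewrite (_ : [set th | _] = B) ?B0 ?mule0//.
by apply/seteqP; split=> th /=; [case|split].
Qed.

End Intensity.

(** * Void events and the cells *)

Section Cells.
Variables (R : realType) (p q : nat) (T : marked_tree p.+1) (T' : marked_tree q.+1).
Hypotheses (p2 : (2 <= p)%N) (q2 : (2 <= q)%N).
Local Notation DLT := (DL T T').
Local Notation o := (tree_root T).
Local Notation o' := (tree_root T').
Local Notation d := (gdist (@adj p.+1 T)).

Lemma lift_fst_exists (y : T) : exists z : DLT, (val z).1 = y.
Proof.
have [y' hy'] := @height_surj _ T' (- height y) (leqW q2).
have yy' : height (y, y').1 + height (y, y').2 == 0 by rewrite /= hy' subrr.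
by exists (exist _ (y, y') yy').
Qed.

Lemma lift_snd_exists (y : T') : exists z : DLT, (val z).2 = y.
Proof.
have [y' hy'] := @height_surj _ T (- height y) (leqW p2).
have yy' : height (y', y).1 + height (y', y).2 == 0 by rewrite /= hy' addNr.
by exists (exist _ (y', y) yy').
Qed.

(** Arbitrary sections of the two projections, through which a function on the graph is read as a
    function on one tree. *)
Definition lift_fst y := sval (cid (lift_fst_exists y)).
Definition lift_snd y := sval (cid (lift_snd_exists y)).

Lemma lift_fstK : cancel lift_fst (fun z : DLT => (val z).1).
Proof. by move=> y; rewrite /lift_fst; case: cid. Qed.

Lemma lift_sndK : cancel lift_snd (fun z : DLT => (val z).2).
Proof. by move=> y; rewrite /lift_snd; case: cid. Qed.

Definition good_fst : set (horospace T T' R) :=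
  good_boundary (fun z : DLT => (val z).1) lift_fst.
Definition good_snd : set (horospace T T' R) :=
  good_boundary (fun z : DLT => (val z).2) lift_snd.

Lemma measurable_good : measurable (good_fst `|` good_snd).
Proof. by apply: measurableU; exact: measurable_good_boundary. Qed.

Lemma nu0_not_good (eta : probability (boundary T) R) (eta' : probability (boundary T') R) :
  is_harmonic_measure eta -> is_harmonic_measure eta' ->
  nu0 p q eta eta' (~` (good_fst `|` good_snd)) = 0%E.
Proof.
move=> heta heta'.
have mB : measurable (~` (good_fst `|` good_snd)).
  by apply: measurableC; exact: measurable_good.
apply: nu0_eq0; apply/eqP; rewrite eq_le measure_ge0 andbT.
  rewrite -(harmonic_good_null p2 lift_fstK heta); apply: le_measure; rewrite ?inE.
  - by rewrite -[X in measurable X]setTI; apply: measurable_boundary_horo.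
  - rewrite -[X in measurable X]setTI; apply: measurable_boundary_horo => //.
    by apply: measurableC; exact: measurable_good_boundary.
  - by move=> w /= ng gw; apply: ng; left.
rewrite -(harmonic_good_null q2 lift_sndK heta'); apply: le_measure; rewrite ?inE.
- by rewrite -[X in measurable X]setTI; apply: measurable_boundary_horo.
- rewrite -[X in measurable X]setTI; apply: measurable_boundary_horo => //.
  by apply: measurableC; exact: measurable_good_boundary.
- by move=> w /= ng gw; apply: ng; right.
Qed.

Lemma good_growth (th : horospace T T' R) (g : int -> DLT) :
  (good_fst `|` good_snd) th -> bigeodesic (@DLadj _ _ T T') g ->
  (exists C, forall n : nat, n%:R - C <= th (g n%:Z)) \/
  (exists C, forall n : nat, n%:R - C <= th (g (- n%:Z))).
Proof.
move=> good bg; have gx := bigeodesic_dl_geodesic bg.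
have [tr tr'] := (@adj_tree _ T, @adj_tree _ T').
have [e_sym _ _ _] := tr; have [e_sym' _ _ _] := tr'.
have [hh hh'] := (@horo_height _ T, @horo_height _ T').
case: good => -[thE hF nF].
  by have [[C HC]|[C HC]] := geodesic_growth tr e_sym' hh hh' hF gx nF;
    [left|right]; exists C => n; rewrite thE; exact: HC.
by have [[C HC]|[C HC]] := geodesic_growth tr' e_sym hh' hh hF (dl_geodesic_sym gx) nF;
  [left|right]; exists C => n; rewrite thE; exact: HC.
Qed.

(** All positions that a path can have after [m] steps if the coordinates of its start are reached
    from the roots in [L] and [L'] steps; [insub] discards pairs whose heights do not cancel. *)
Definition dl_candidates (L L' m : nat) : seq DLT :=
  pmap insub [seq (a, b) | a <- walk_ends (L + m) o, b <- walk_ends (L' + m) o'].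

Lemma size_dl_candidates L L' m : (size (dl_candidates L L' m) <=
  p.+1 ^ L * q.+1 ^ L' * (p.+1 * q.+1) ^ m)%N.
Proof.
rewrite size_pmap; apply: leq_trans (count_size _ _) _.
rewrite size_allpairs !size_walk_ends !expnD expnMn.
by rewrite leq_eqVlt; apply/orP; left; apply/eqP; ring.
Qed.

Lemma mem_dl_candidates L L' m (z : nat -> DLT) :
  (forall n, adj (val (z n)).1 (val (z n.+1)).1) ->
  (forall n, adj (val (z n)).2 (val (z n.+1)).2) ->
  has_walk (@adj _ T) o (val (z 0%N)).1 L ->
  has_walk (@adj _ T') o' (val (z 0%N)).2 L' ->
  z m \in dl_candidates L L' m.
Proof.
move=> zT zT' oL oL'; rewrite mem_pmap_sub; apply/allpairsP.
exists (val (z m)); rewrite -surjective_pairing; split=> //; apply: walk_endsP.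
  exact: has_walk_cat oL (has_walk_seq (fun i _ => zT i)).
exact: has_walk_cat oL' (has_walk_seq (fun i _ => zT' i)).
Qed.

Section Process.
Variables (xi : R) (D : measure_display) (Om : measurableType D) (P : probability Om R).
Variables (Theta : nat -> Om -> horospace T T' R) (Delta : nat -> Om -> int).
Variables (eta : probability (boundary T) R) (eta' : probability (boundary T') R).
Hypotheses (heta : is_harmonic_measure eta) (heta' : is_harmonic_measure eta').
Hypothesis pois : is_poisson_process P (intensity p q eta eta' xi)
  (fun i s => (Theta i s, Delta i s)).

(* - d o (val z).1 is the least value at z of a horofunction rhoT w; it is attained
   exactly when w is in the shadow of (val z).1. *)
Definition deep (z : DLT) : set (horospace T T' R) :=
  [set th | th z <= - (d o (val z).1)%:R].

Definition void (z : DLT) (i : int) : set Om :=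
  [set s | forall j, ~ (deep z `*` [set i]) (Theta j s, Delta j s)].

Lemma measurable_deep (z : DLT) : measurable (deep z).
Proof.
have := @measurable_eval R _ _ _ _ z measurableT `]-oo, (- (d o (val z).1)%:R)]%classic.
rewrite setTI => /(_ (measurable_itv _)); congr measurable.
Qed.

Lemma measurable_void z i : measurable (void z i).
Proof.
have [mZ _ _ _] := pois; rewrite /void.
have -> : [set s | forall j, ~ (deep z `*` [set i]) (Theta j s, Delta j s)] =
    \bigcap_j (setT `&` (fun s => (Theta j s, Delta j s)) @^-1` ~` (deep z `*` [set i])).
  by apply/seteqP; split=> [s H j _|s H j]; [split=> //; exact: H|have [] := H j I].
apply: bigcapT_measurable => j; apply: mZ => //.
by apply: measurableC; apply: measurableX => //; exact: measurable_deep.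
Qed.

Lemma void_le (C : nat) : exists2 c, 0 < c & forall z (m : nat),
  (P (void z (m%:Z - C%:Z - 1 + (d o (val z).1)%:Z)) <= (expR (- (c * p%:R ^+ m)))%:E)%E.
Proof.
have p0 : 0 < p%:R :> R by rewrite ltr0n ltnW.
have p1R : 0 < p%:R - 1 :> R by rewrite subr_gt0 ltr1n.
(* The first two factors are [beta_xi] at the layer without [p ^ m] and [p ^ n]; the last two bound
   the measure of the shadow without [p ^- n]. The powers with exponent [n] cancel. *)
exists ((p%:R - 1) * p%:R `^ (xi - C%:R - 2) * (2^-1 * (p%:R / p.+1%:R))).
  by rewrite !mulr_gt0 ?powR_gt0 ?invr_gt0.
move=> z m; set n := d o (val z).1; set i := (_ + n%:Z).
set B := deep z.
have p1 : (1 <= p)%N := ltnW p2.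
have muE := intensity_layer q eta eta' xi p1 B i.
have mB : measurable B by exact: measurable_deep.
have mrho : measurable (@rhoT _ _ T T' R @^-1` B).
  by rewrite -[X in measurable X]setTI; apply: (measurable_boundary_horo (T := T)).
have mrho' : measurable (@rhoT' _ _ T T' R @^-1` B).
  by rewrite -[X in measurable X]setTI; apply: (measurable_boundary_horo (T := T')).
have nufin : nu0 p q eta eta' B \is a fin_num.
  rewrite /nu0 /pushforward; case: ifP => _; first exact: fin_num_measure.
  by rewrite fin_numM// fin_numD !fin_num_measure.
have nuB : 2^-1 * (p%:R / p.+1%:R * p%:R ^- n) <= fine (nu0 p q eta eta' B).
  rewrite -lee_fin fineK// EFinM; apply: le_trans (nu0_ge p q eta eta' B).
  rewrite lee_pmul2l ?lte_fin ?invr_gt0//.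
  exact: (harmonic_shadow_ge (fun z : DLT => (val z).1) p2 z heta).
rewrite /void (poisson_void pois) ?muE; last 2 first.
- exact: measurableX.
- by rewrite fin_numM.
rewrite -(fineK nufin) -EFinM /= lee_fin ler_expR lerN2.
have beta_pos : 0 < beta_xi p xi i by rewrite mulr_gt0 ?powR_gt0.
apply: le_trans (ler_wpM2l (ltW beta_pos) nuB).
rewrite /beta_xi (_ : i%:~R - 1 + xi = m%:R + (n%:R + (xi - C%:R - 2))); last first.
  rewrite /i !rmorphD !rmorphN /= -![_%:Z%:~R]/(_%:R); ring.
have pD (r e : R) : p%:R `^ (r + e) = p%:R `^ r * p%:R `^ e.
  by rewrite powRD// (gt_eqF p0) implybT.
rewrite (pD m%:R) (pD n%:R) !powR_mulrn ?(ltW p0)//.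
rewrite le_eqVlt; apply/orP; left; apply/eqP.
by field; rewrite expf_neq0 ?gt_eqF// natr1 pnatr_eq0.
Qed.

(** The vertices for different [m] may be chosen independently. The event is thus a countable
    intersection of finite unions, and each union alone bounds its probability. *)
Lemma void_walk_null (L L' C : nat) : {ae P, forall s,
  ~ (forall m : nat, exists2 z, z \in dl_candidates L L' m &
       void z (m%:Z - C%:Z - 1 + (d o (val z).1)%:Z) s)}.
Proof.
have [c c0 voidc] := void_le C.
have K0 : (0 < p.+1 * q.+1)%N by [].
have [M decay] := exponential_decay K0 p2 c0.
pose E m := \big[setU/set0]_(z <- dl_candidates L L' m)
  void z (m%:Z - C%:Z - 1 + (d o (val z).1)%:Z).
have mE m : measurable (E m).
  by apply: bigsetU_measurable => z _; exact: measurable_void.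
have mI : measurable (\bigcap_m E m) by exact: bigcapT_measurable.
exists (\bigcap_m E m); split=> //.
  pose a : R := (p.+1 ^ L * q.+1 ^ L')%:R.
  apply: (@geometric_le_eq0 _ _ (a * M) 2^-1) => //.
    by rewrite invr_ge0 invf_lt1// ltr1n ler0n.
  move=> m; apply: (@le_trans _ _ (P (E m))).
    by apply: le_measure; rewrite ?inE// => s; apply.
  have mV z : measurable (void z (m%:Z - C%:Z - 1 + (d o (val z).1)%:Z)).
    exact: measurable_void.
  apply: le_trans (union_bound (dl_candidates L L' m) mV (voidc ^~ m)) _.
  rewrite lee_fin -mulrA; apply: le_trans (ler_wpM2l _ (decay m)); last by rewrite ler0n.
  rewrite mulrA; apply: ler_wpM2r; first exact: expR_ge0.
  by rewrite -natrX -natrM ler_nat; exact: size_dl_candidates.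
move=> s /contrapT H m _; have [z zc vz] := H m.
by rewrite /E -bigcup_seq; exists z.
Qed.

(** The bad functions have intensity 0 over all layers together, so a Poisson process has none with
    probability [expR 0]. *)
Lemma good_ae : {ae P, forall s, forall i, (good_fst `|` good_snd) (Theta i s)}.
Proof.
set G := good_fst `|` good_snd.
have p1 : (1 <= p)%N := ltnW p2.
have mG : measurable (~` G) by apply: measurableC; exact: measurable_good.
have nu_null : intensity p q eta eta' xi (~` G `*` setT) = 0%E.
  by apply: intensity_null; exact: nu0_not_good.
have mA : measurable (~` G `*` (setT : set int)) by exact: measurableX.
have := poisson_void pois mA; rewrite nu_null => /(_ isT); rewrite oppr0 expR0.
set V := [set s | _] => PV.
have mV : measurable V.
  have [mZ _ _ _] := pois.
  have -> : V = \bigcap_j (setT `&` (fun s => (Theta j s, Delta j s)) @^-1` ~` (~` G `*` setT)).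
    by apply/seteqP; split=> [s H j _|s H j]; [split=> //; exact: H|have [] := H j I].
  by apply: bigcapT_measurable => j; apply: mZ => //; exact: measurableC.
exists (~` V); split; first exact: measurableC.
  by rewrite probability_setC// PV subee.
move=> s bad Vs; apply: bad => i; apply: contrapT => nG.
exact: (Vs i (conj nG I)).
Qed.

End Process.
End Cells.

Theorem proposition6p11 (R : realType) (p q : nat) (hq : (2 <= q)%N)
    (hpq : (q <= p)%N) (T : marked_tree p.+1) (T' : marked_tree q.+1) (xi : R)
    (D : measure_display) (Om : measurableType D) (P : probability Om R)
    (Theta : nat -> Om -> horospace T T' R) (Delta : nat -> Om -> int) :
  is_IPVT_nuclei xi P Theta Delta ->
  {ae P, forall s, forall i, ~ exists g : int -> DL T T',
    bigeodesic (@DLadj _ _ T T') g /\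
    forall m, horo_cell (Theta ^~ s) (Delta ^~ s) i (g m)}.
Proof.
move=> [_ [eta [eta' [heta heta' pois]]]]; have hp := leq_trans hq hpq.
have nowalk : {ae P, forall s, forall L L' C : nat, ~ (forall m : nat,
    exists2 z, z \in dl_candidates T T' L L' m &
    void Theta Delta z (m%:Z - C%:Z - 1 + (gdist (@adj _ T) (tree_root T) (val z).1)%:Z) s)}.
  apply: ae_foralln => L; apply: ae_foralln => L'; apply: ae_foralln => C.
  exact: (void_walk_null hp heta pois).
apply: filterS2 nowalk (good_ae hp hq heta heta' pois) => s nowalk_s good_s i [g [bg cell]].
have [adjg adjg' _ _] := bigeodesic_dl_geodesic bg.
have [e_sym _ conn _] := @adj_tree _ T; have [e_sym' _ conn' _] := @adj_tree _ T'.
(* [z] is the half of the geodesic along which the horofunction of the nucleus grows, run in the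
   direction of growth. *)
suff escape (z : nat -> DL T T') : (forall n, adj (val (z n)).1 (val (z n.+1)).1) ->
    (forall n, adj (val (z n)).2 (val (z n.+1)).2) ->
    (forall n, horo_cell (Theta ^~ s) (Delta ^~ s) i (z n)) ->
    ~ exists C, forall n : nat, n%:R - C <= Theta i s (z n).
  have [grow|grow] := good_growth (good_s i) bg.
    apply: (escape (fun n => g n%:Z)) => // n.
      by have -> : n.+1%:Z = n%:Z + 1 by lia.
    by have -> : n.+1%:Z = n%:Z + 1 by lia.
  apply: (escape (fun n => g (- n%:Z))) => // n.
    by rewrite e_sym; have -> : - n%:Z = - n.+1%:Z + 1 by lia.
  by rewrite e_sym'; have -> : - n%:Z = - n.+1%:Z + 1 by lia.
move=> zT zT' zcell [C growth].
have [L oL] := conn (tree_root T) (val (z 0%N)).1.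
have [L' oL'] := conn' (tree_root T') (val (z 0%N)).2.
(* A nucleus [j] in the layer of [void] would have [f_j (z m) <= m - C' - 1], while growth gives
   [f_i (z m) >= m - C + Delta i s], which exceeds [m - C']. The cell condition forbids this, so the
   event is void at [z m]. *)
pose C' := Num.bound `|C - (Delta i s)%:~R|.
apply: (nowalk_s L L' C') => m.
exists (z m); first exact: mem_dl_candidates.
move=> j [low deltaj]; have {}low : Theta j s (z m) <=
    - (gdist (@adj _ T) (tree_root T) (val (z m)).1)%:R by [].
have := zcell m j; have := growth m.
have := archi_boundP (normr_ge0 (C - (Delta i s)%:~R)); rewrite -/C'.
have := ler_norm (C - (Delta i s)%:~R).
rewrite [Delta j s]deltaj !rmorphD !rmorphN /= -![_%:Z%:~R]/(_%:R).
by move=> h1 h2 h3 h4; lra.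
Qed.
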